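(* Let $M^m$, $m>2$, be a proper biharmonic submanifold of dimension $m$ in the unit Euclidean sphere $\mathbb{S}^n$, with mean curvature vector field $H$ and Weingarten operator $A_H$ associated to $H$. If $\nabla^\perp H=0$, $\nabla A_H=0$ and $|H|\in\left(0,\frac{m-2}{m}\right)$, then $M$ has two distinct principal curvatures $\lambda$ and $\mu$ in the direction of $H$, of different multiplicities $m_1$ and $m_2$, respectively, and $$\lambda=\frac{m_1-m_2}{m},\qquad \mu=-\frac{m_1-m_2}{m},\qquad |H|=\frac{|m_1-m_2|}{m}.$$
   Context: All manifolds, metrics and maps are smooth, and all manifolds are connected. A map $\phi:(M,g)\to(N,h)$ between Riemannian manifolds has tension field $\tau(\phi)=\mathrm{trace}\,\nabla d\phi$; it is harmonic if $\tau(\phi)=0$, and biharmonic if $\tau_2(\phi)=-\Delta\tau(\phi)-\mathrm{trace}\,R^N(d\phi\cdot,\tau(\phi))d\phi\cdot=0$, where $\Delta V=-\mathrm{trace}\,\nabla^2V$ for sections $V$ of $\phi^{-1}(TN)$ and $R^N(X,Y)=[\nabla_X,\nabla_Y]-\nabla_{[X,Y]}$. A submanifold (with the induced metric) is called proper biharmonic if its inclusion map is biharmonic but not harmonic (i.e. the submanifold is not minimal). For a submanifold $M^m\subset\mathbb{S}^n$: $B$ is the second fundamental form, $H=\frac1m\,\mathrm{trace}\,B$ is the mean curvature vector field, $|H|$ is the mean curvature, $\nabla^\perp$ is the normal connection, $\nabla$ is the Levi-Civita connection of $M$, and for a normal vector field $\eta$ the Weingarten operator $A_\eta$ is given by $\langle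 A_\eta(X),Y\rangle=\langle B(X,Y),\eta\rangle$. The principal curvatures in the direction of $H$ are the eigenvalues of $A_H$. *)

(* Defs.v *)
From HB Require Import structures.
From mathcomp Require Import all_boot all_order all_algebra.
From mathcomp Require Import all_classical all_reals all_analysis.

Set Implicit Arguments.
Unset Strict Implicit.
Unset Printing Implicit Defensive.

Import Order.TTheory GRing.Theory Num.Theory.
Import numFieldNormedType.Exports.

Local Open Scope classical_set_scope.
Local Open Scope ring_scope.

(* R^k is 'rV[R]_k; its library norm is the sup norm, which
   is used for the topology only.  Lengths and angles come from dot. *)

Definition dot (R : realType) (k : nat) (v w : 'rV[R]_k) : R :=
  \sum_(i < k) v 0 i * w 0 i.

Definition enorm (R : realType) (k : nat) (v : 'rV[R]_k) : R :=
  Num.sqrt (dot v v).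

Definition basis_vec (R : realType) (m : nat) (i : 'I_m) : 'rV[R]_m :=
  delta_mx 0 i.

(* [:: v1; ...; vr] gives D_v1 (... (D_vr f)). *)
Fixpoint iter_derive (R : realType) (V W : normedModType R) (vs : seq V)
    (f : V -> W) : V -> W :=
  if vs is v :: vs' then fun x => 'D_v (iter_derive vs' f) x else f.

(* C^infinity on an open set U: directional derivatives of every order exist
   and are differentiable (hence continuous) on U. *)
Definition smooth_on (R : realType) (V W : normedModType R) (U : set V)
    (f : V -> W) : Prop :=
  forall (vs : seq V) (x : V), U x -> differentiable (iter_derive vs f) x.

(* A chart i is the homeomorphism coord i from the open set dom i onto the open
   set img i of R^m, with inverse param i; the values of coord i outside dom i
   and of param i outside img i are irrelevant. *)
Record manifold (R : realType) (m : nat) := Manifold {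
  points :> topologicalType ;
  chart : Type ;
  dom : chart -> set points ;
  img : chart -> set 'rV[R]_m ;
  coord : chart -> points -> 'rV[R]_m ;
  param : chart -> 'rV[R]_m -> points ;
  manifold_hausdorff : hausdorff_space points ;
  manifold_second_countable : @second_countable points ;
  manifold_connected : connected [set: points] ;
  chart_cover : forall p, exists i, dom i p ;
  dom_open : forall i, open (dom i) ;
  img_open : forall i, open (img i) ;
  coord_img : forall i p, dom i p -> img i (coord i p) ;
  param_dom : forall i u, img i u -> dom i (param i u) ;
  coordK : forall i p, dom i p -> param i (coord i p) = p ;
  paramK : forall i u, img i u -> coord i (param i u) = u ;
  coord_continuous : forall i, {within dom i, continuous (coord i)} ;
  param_continuous : forall i, {within img i, continuous (param i)} ;
  transition_smooth : forall i j,
    smooth_on (img i `&` param i @^-1` dom j) (coord j \o param i)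
}.

Section Patch.
Context {R : realType} {m : nat}.
Local Notation E := 'rV[R]_m.
Local Notation e := (@basis_vec R m).

(* A metric G on (an open set of) R^m is given by its Gram matrix in the
   coordinate frame; a tangent vector is the row of its coordinates. *)
Implicit Type G : E -> 'M[R]_m.

(* The coordinates (Gamma^k_ij)_k of nabla_{d_i} d_j. *)
Definition christoffel G (u : E) (i j : 'I_m) : E :=
  \row_k (2%:R^-1 * \sum_(l < m) invmx (G u) k l *
    ('D_(e i) (fun w => G w j l) u + 'D_(e j) (fun w => G w i l) u
     - 'D_(e l) (fun w => G w i j) u)).

(* nabla_X Y at u, for a vector X at u and a vector field Y. *)
Definition levi_civita G (X : E) (Y : E -> E) (u : E) : E :=
  'D_X Y u + \sum_(i < m) \sum_(j < m) (X 0 i * Y u 0 j) *: christoffel G u i j.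

Definition metric_trace {k : nat} G (u : E) (b : E -> E -> 'rV[R]_k) :
    'rV[R]_k :=
  \sum_(i < m) \sum_(j < m) invmx (G u) i j *: b (e i) (e j).

End Patch.

Section Sphere.
Context {R : realType} {n : nat}.
Local Notation F := 'rV[R]_n.+1.

Definition sphere : set F := [set x | dot x x = 1].

(* For x in the sphere, the orthogonal projection onto its tangent space. *)
Definition tproj (x v : F) : F := v - dot v x *: x.

(* Vector fields on the sphere are represented by maps on R^(n+1) that are
   tangent along the sphere.  The Levi-Civita connection of the sphere is the
   tangential part of the flat one; at points of the sphere the values below
   depend only on the fields along the sphere. *)
Definition sphere_conn (X Y : F -> F) (x : F) : F := tproj x ('D_(X x) Y x).

Definition bracket (X Y : F -> F) (x : F) : F :=
  'D_(X x) Y x - 'D_(Y x) X x.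

Definition sphere_curv_fields (X Y Z : F -> F) (x : F) : F :=
  sphere_conn X (sphere_conn Y Z) x - sphere_conn Y (sphere_conn X Z) x
  - sphere_conn (bracket X Y) Z x.

(* R(a,b)c for a, b, c tangent at x: the curvature is a tensor, so it may be
   evaluated on any tangent fields extending a, b, c, here y |-> tproj y a. *)
Definition sphere_curv (x a b c : F) : F :=
  sphere_curv_fields (tproj^~ a) (tproj^~ b) (tproj^~ c) x.

End Sphere.

Section MapsToSphere.
Context {R : realType} {m n : nat}.
Local Notation E := 'rV[R]_m.
Local Notation F := 'rV[R]_n.+1.
Variables (G : E -> 'M[R]_m) (f : E -> F).

(* The connection of f^{-1}(T S^n), acting on a section V along f. *)
Definition pullback_conn (X : E) (V : E -> F) (u : E) : F :=
  tproj (f u) ('D_X V u).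

(* (nabla df)(X,Y) and (nabla^2 V)(X,Y): Y is extended by the field with
   constant coordinates. *)
Definition nabla_d (X Y : E) (u : E) : F :=
  pullback_conn X (fun w => 'D_Y f w) u - 'D_(levi_civita G X (cst Y) u) f u.

Definition nabla2 (V : E -> F) (X Y : E) (u : E) : F :=
  pullback_conn X (fun w => pullback_conn Y V w) u
  - pullback_conn (levi_civita G X (cst Y) u) V u.

Definition tension (u : E) : F :=
  metric_trace G u (fun X Y => nabla_d X Y u).

Definition rough_laplacian (V : E -> F) (u : E) : F :=
  - metric_trace G u (fun X Y => nabla2 V X Y u).

Definition bitension (u : E) : F :=
  - rough_laplacian tension u
  - metric_trace G u
      (fun X Y => sphere_curv (f u) ('D_X f u) (tension u) ('D_Y f u)).

End MapsToSphere.

Section SubmanifoldPatch.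
Context {R : realType} {m n : nat}.
Local Notation E := 'rV[R]_m.
Local Notation F := 'rV[R]_n.+1.
Local Notation e := (@basis_vec R m).
Variable f : E -> F.

Definition induced_metric (u : E) : 'M[R]_m :=
  \matrix_(i, j) dot ('D_(e i) f u) ('D_(e j) f u).

(* Component orthogonal to the image of df(u). *)
Definition normal_part (u : E) (w : F) : F :=
  w - \sum_(i < m) \sum_(j < m)
        (invmx (induced_metric u) i j * dot w ('D_(e j) f u)) *: 'D_(e i) f u.

(* B(X,Y): the normal component of the sphere's nabla_X Y. *)
Definition second_form (X Y : E) (u : E) : F :=
  normal_part u (pullback_conn f X (fun w => 'D_Y f w) u).

Definition mean_curv (u : E) : F :=
  m%:R^-1 *: metric_trace induced_metric u (fun X Y => second_form X Y u).

Definition normal_conn (X : E) (eta : E -> F) (u : E) : F :=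
  normal_part u (pullback_conn f X eta u).

(* A_eta acts on rows of coordinates by X |-> X *m weingarten eta u; this is the
   unique matrix with <A_eta X, Y> = <B(X,Y), eta> for the induced metric. *)
Definition weingarten (eta : E -> F) (u : E) : 'M[R]_m :=
  (\matrix_(i, j) dot (second_form (e i) (e j) u) (eta u))
    *m invmx (induced_metric u).

(* (nabla_X A) Y = nabla_X (A Y) - A (nabla_X Y). *)
Definition nabla_endo (A : E -> 'M[R]_m) (X Y : E) (u : E) : E :=
  levi_civita induced_metric X (fun w => Y *m A w) u
  - levi_civita induced_metric X (cst Y) u *m A u.

End SubmanifoldPatch.

Record sphere_submanifold (R : realType) (m n : nat) := SphereSubmanifold {
  carrier :> manifold R m ;
  incl : carrier -> 'rV[R]_n.+1 ;
  incl_sphere : forall p, sphere (incl p) ;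
  incl_smooth : forall i, smooth_on (@img _ _ carrier i) (incl \o param i) ;
  incl_immersion : forall i u, @img _ _ carrier i u ->
    forall v : 'rV[R]_m, v != 0 -> 'D_v (incl \o param i) u != 0
}.

Section Submanifold.
Context {R : realType} {m n : nat}.
Variable M : sphere_submanifold R m n.

(* The inclusion read in the chart i. *)
Definition patch (i : chart M) : 'rV[R]_m -> 'rV[R]_n.+1 := @incl _ _ _ M \o param i.

Definition harmonic : Prop :=
  forall (i : chart M) u, img i u ->
    tension (induced_metric (patch i)) (patch i) u = 0.

Definition biharmonic : Prop :=
  forall (i : chart M) u, img i u ->
    bitension (induced_metric (patch i)) (patch i) u = 0.

Definition proper_biharmonic : Prop := biharmonic /\ ~ harmonic.

(* |H| and A_H at the point with coordinates u in the chart i. *)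
Definition mean_curvature (i : chart M) (u : 'rV[R]_m) : R :=
  enorm (mean_curv (patch i) u).

Definition A_H (i : chart M) (u : 'rV[R]_m) : 'M[R]_m :=
  weingarten (patch i) (mean_curv (patch i)) u.

Definition parallel_mean_curv : Prop :=
  forall (i : chart M) u, img i u ->
    forall X, normal_conn (patch i) X (mean_curv (patch i)) u = 0.

Definition parallel_A_H : Prop :=
  forall (i : chart M) u, img i u ->
    forall X Y, nabla_endo (patch i) (A_H i) X Y u = 0.

End Submanifold.

(* Main.v *)
Require Import Defs.
From HB Require Import structures.
From mathcomp Require Import all_boot all_order all_algebra.
From mathcomp Require Import all_classical all_reals all_analysis.
From mathcomp Require Import ring lra zify.

(** Write $f$ for the inclusion read in a chart, $II$ for the second fundamental
    form of $M$ in the Euclidean space, so that $II = B - g f$, and $A = A_H$.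

    Since $H$ is parallel in the normal bundle, $\partial_k H$ is tangent to $M$
    and equals $-df(A e_k)$ ([derive_mean_curv]).  Three consequences are drawn
    from the symmetry of mixed derivatives.

    - The normal part of $\partial_p\partial_k H$ is $-II(e_p, A e_k)$; as it is
      symmetric, $II(X, AY) = II(AX, Y)$, which is the Ricci equation
      ([twistedC]).

    - The condition $\nabla A = 0$ says that
      $\langle\partial_p\partial_k H, \partial_r f\rangle =
       \langle\partial_p\partial_k f, \partial_r H\rangle$ ([parallel_shape]).
      Differentiating once more and exchanging the two outer derivatives gives
      $$\langle II(p,Ak), II(q,r)\rangle - \langle II(q,Ak), II(p,r)\rangle =
        \langle II(p,k), II(q,Ar)\rangle - \langle II(q,k), II(p,Ar)\rangle,$$
      that is, the curvature tensor of $M$, written by the Gauss equation,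
      commutes with $A$ ([gauss_identity]).

    - The normal part of the biharmonic equation is
      $\mathrm{trace}\, B(\cdot, A\,\cdot) = mH$ ([biharmonic_normal]).

    Tracing the second identity over $p = k$, its last terms on both sides cancel
    by the first one, and what remains is
    $\langle \mathrm{trace}\, II(\cdot, A\,\cdot), II(q,r)\rangle =
     \langle \mathrm{trace}\, II, II(q, Ar)\rangle$.  Both traces are known: they
    are $mH - (\mathrm{trace}\, A) f$ and $m(H - f)$.  Expanding the products
    leaves $A^2 = |H|^2$ ([square_shape]), while $\mathrm{trace}\, A = m|H|^2$
    ([trace_shape]).

    Hence the eigenvalues of $A$ are $\pm|H|$, with multiplicities
    $m(1 \pm |H|)/2$, because $(A \pm |H|)/(\pm 2|H|)$ is the projection onto the
    eigenspace and the trace of a projection is its rank.  Both multiplicities are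
    positive since $0 < |H| < 1$, and their difference is $m|H|$.

    The function $m(1 + |H|)/2$ is therefore continuous with integer values; it
    does not depend on the chart ([mean_curv_reparam]), so it is constant on the
    connected manifold $M$ and the multiplicities are the same everywhere. *)

Set Implicit Arguments.
Unset Strict Implicit.
Unset Printing Implicit Defensive.

Import Order.TTheory GRing.Theory Num.Theory.
Import numFieldNormedType.Exports.
Local Open Scope classical_set_scope.
Local Open Scope ring_scope.

(** * Symmetry of second derivatives *)

Section Calculus.
Context {R : realType}.
Implicit Types V W : normedModType R.

Lemma derive_comp V W (Z : normedModType R) (phi : V -> W) (g : W -> Z) x v :
  differentiable phi x -> differentiable g (phi x) ->
  'D_v (g \o phi) x = 'D_('D_v phi x) g (phi x).
Proof.
move=> dphi dg; rewrite !deriveE//; first by rewrite diff_comp.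
exact: differentiable_comp.
Qed.

Lemma derive_line V (g : V -> R) (b v : V) (t : R) :
  differentiable g (t *: v + b) ->
  is_derive t 1 (fun s : R => g (s *: v + b)) ('D_v g (t *: v + b)).
Proof.
move=> dg.
have dl : is_diff t (fun s : R => s *: v + b) ( *:%R^~ v).
  have -> : (fun s : R => s *: v + b) = ( *:%R^~ v : R -> V) + cst b by [].
  by apply: is_diff_eq; rewrite addr0.
have dlt : differentiable (fun s : R => s *: v + b) t by exact: ex_diff.
have dc : differentiable (g \o (fun s : R => s *: v + b)) t.
  exact: differentiable_comp.
apply: DeriveDef; first exact: diff_derivable.
rewrite -[LHS]/('D_1 (g \o (fun s : R => s *: v + b)) t) derive_comp//.
by congr ('D_ _ g _); rewrite deriveE// diff_val scale1r.
Qed.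

Lemma diff_increment V (p : V -> R) (a : V) (e : R) : 0 < e ->
  differentiable p a ->
  exists2 d, 0 < d & forall h : V, `|h| < d ->
    `|p (h + a) - p a - 'd p a h| <= e * `|h|.
Proof.
move=> e0 /diff_locally E.
have /eqoP /(_ e e0) : (p \o shift a - (cst (p a) + 'd p a)) =o_ (0 : V) id.
  by rewrite {1}E addrC addKr.
move=> /nbhs_normP[d /= d0 H]; exists d => // h hd.
have := H h; rewrite /= sub0r normrN => /(_ hd).
by rewrite opprD addrA.
Qed.

(** The mean value theorem, applied to $t \mapsto g(a+tv+sw) - g(a+tv)$, turns
    the second difference into an increment of $D_v g$, which differentiability
    of $D_v g$ at $a$ estimates up to $o(s)$. *)
Lemma second_difference V (g : V -> R) (a v w : V) (e : R) : 0 < e ->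
  (\forall y \near a, differentiable g y) -> differentiable ('D_v g) a ->
  exists2 d, 0 < d & forall s : R, 0 < s < d ->
    `|g (s *: v + (s *: w + a)) - g (s *: v + a) - g (s *: w + a) + g a
      - s ^+ 2 * 'D_w ('D_v g) a| <= e * s ^+ 2.
Proof.
move=> e0 /nbhs_normP[d1 /= d10 dg] dp.
(* For 0 <= c <= s, the increments c v + s w and c v have total norm at most
   s (2|v| + |w|); the 1 makes K positive. *)
pose K := 2 * `|v| + `|w| + 1.
have K0 : 0 < K by rewrite /K ltr_wpDl// addr_ge0// mulr_ge0.
have [d2 d20 H] := diff_increment (divr_gt0 e0 K0) dp.
pose d := Num.min d1 d2 / K.
exists d; first by rewrite divr_gt0// lt_min d10.
move=> s /andP[s0 sd].
have sK : s * K < Num.min d1 d2 by rewrite -ltr_pdivlMr.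
have nb1 t : 0 <= t <= s -> `|t *: v + s *: w| <= s * (`|v| + `|w|).
  move=> /andP[t0 ts]; apply: (le_trans (ler_normD _ _)).
  by rewrite !normrZ (ger0_norm t0) (gtr0_norm s0) mulrDr lerD2r ler_wpM2r.
have nb2 t : 0 <= t <= s -> `|t *: v| <= s * `|v|.
  by move=> /andP[t0 ts]; rewrite normrZ (ger0_norm t0) ler_wpM2r.
have sv : s * (`|v| + `|w|) < s * K.
  by rewrite ltr_pM2l// /K mulrDl mul1r; have := normr_ge0 v; lra.
have sv' : s * `|v| < s * K.
  rewrite ltr_pM2l// /K mulrDl mul1r; have := normr_ge0 v.
  by have := normr_ge0 w; lra.
have small (h : V) : `|h| < s * K -> `|h| < d1 /\ `|h| < d2.
  by move=> /lt_trans/(_ sK); rewrite lt_min => /andP[].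
have dgl h : `|h| < s * K -> differentiable g (h + a).
  move=> /small[hd _]; apply: dg => /=.
  by rewrite opprD addrCA subrr addr0 normrN.
have dl1 t : 0 <= t <= s -> differentiable g (t *: v + (s *: w + a)).
  by move=> ts; rewrite addrA; apply/dgl/(le_lt_trans (nb1 _ ts)).
have dl2 t : 0 <= t <= s -> differentiable g (t *: v + a).
  by move=> ts; apply/dgl/(le_lt_trans (nb2 _ ts)).
pose u t := g (t *: v + (s *: w + a)) - g (t *: v + a).
pose du t := 'D_v g (t *: v + (s *: w + a)) - 'D_v g (t *: v + a).
have ud t : 0 <= t <= s -> is_derive t 1 u (du t).
  move=> ts; have ? := derive_line (dl1 _ ts); have ? := derive_line (dl2 _ ts).
  exact: is_deriveB.
have [c cs E] : exists2 c, c \in `]0, s[%R & u s - u 0 = du c * (s - 0).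
  apply: MVT => //.
    by move=> t; rewrite in_itv/= => /andP[t0 ts]; apply: ud; rewrite !ltW.
  apply: derivable_within_continuous => t; rewrite in_itv/= => ts.
  by have := ud t ts => -[].
have {}cs : 0 <= c <= s by move: cs; rewrite in_itv/= => /andP[??]; rewrite !ltW.
have -> : g (s *: v + (s *: w + a)) - g (s *: v + a) - g (s *: w + a) + g a
    = du c * s.
  by move: E; rewrite subr0 => <-; rewrite /u !scale0r !add0r; ring.
have h1 := H _ (small _ (le_lt_trans (nb1 _ cs) sv)).2.
have h2 := H _ (small _ (le_lt_trans (nb2 _ cs) sv')).2.
have Dw : 'd ('D_v g) a (c *: v + s *: w)
    = 'd ('D_v g) a (c *: v) + s * 'D_w ('D_v g) a.
  by rewrite linearD deriveE// [X in _ + X]linearZ.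
rewrite expr2 -mulrA mulrCA (mulrC (du c)) -mulrBr normrM (gtr0_norm s0) mulrA.
rewrite (mulrC e) -mulrA ler_pM2l// /du addrA.
set D := 'D_w _ _ in Dw *.
set p1 := 'D_v g (_ + a) in h1 *.
set p2 := 'D_v g (_ + a) in h2 *.
have -> : p1 - p2 - s * D =
   (p1 - 'D_v g a - 'd ('D_v g) a (c *: v + s *: w))
   - (p2 - 'D_v g a - 'd ('D_v g) a (c *: v)).
  by rewrite Dw; ring.
apply: (le_trans (ler_normB _ _)).
apply: (le_trans (lerD h1 h2)).
rewrite -mulrDr -[leRHS](mulfVK (lt0r_neq0 K0)) [e * s](mulrC) -!mulrA.
rewrite [leRHS]mulrCA ler_pM2l// ?divr_gt0//.
rewrite mulrCA ler_pM2l ?invr_gt0//.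
apply: (le_trans (lerD (nb1 _ cs) (nb2 _ cs))).
by rewrite -mulrDr ler_pM2l// /K; lra.
Qed.

(** The second difference is symmetric in the two directions, and divided by
    $s^2$ it tends to either mixed derivative. *)
Lemma derive_schwarz V (g : V -> R) (a v w : V) :
  (\forall y \near a, differentiable g y) ->
  differentiable ('D_v g) a -> differentiable ('D_w g) a ->
  'D_v ('D_w g) a = 'D_w ('D_v g) a.
Proof.
move=> dg dv dw; apply/eqP; rewrite -subr_eq0 -normr_le0.
apply/ler_addgt0Pl => e e0; rewrite addr0.
have e20 : 0 < e / 2 by rewrite divr_gt0.
have [d1 d10 H1] := second_difference w e20 dg dv.
have [d2 d20 H2] := second_difference v e20 dg dw.
pose s := Num.min d1 d2 / 2.
have s0 : 0 < s by rewrite divr_gt0// lt_min d10.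
have sm : s < Num.min d1 d2 by rewrite ltr_pdivrMr// mulr2n mulrDr mulr1 ltrDl lt_min d10.
move: (sm); rewrite lt_min => /andP[s1 s2].
have {H1} := H1 s; rewrite s0 s1 => /(_ isT) H1.
have {H2} := H2 s; rewrite s0 s2 => /(_ isT) H2.
rewrite (addrCA (s *: w)) in H2.
set L := 'D_v ('D_w g) a in H2 *; set L' := 'D_w ('D_v g) a in H1 *.
have ss0 : 0 < s ^+ 2 by rewrite exprn_gt0.
rewrite -(ler_pM2l ss0) -{1}(gtr0_norm ss0) -normrM.
rewrite (mulrC _ e) (splitr e) mulrDl.
apply: le_trans (lerD H1 H2); apply: le_trans (ler_normB _ _).
rewrite le_eqVlt; apply/orP; left; apply/eqP; congr (`| _ |).
ring.
Qed.

End Calculus.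

(** * Closure properties of smooth maps *)

Section Smooth.
Context {R : realType} {V : normedModType R}.
Implicit Types W : normedModType R.

(** A map that agrees with $f$ near $x$ has the same first-order expansion. *)
Lemma near_eq_differentiable W (f g : V -> W) (x : V) :
  {near x, f =1 g} -> differentiable f x -> differentiable g x.
Proof.
move=> fg df; have dc : continuous ('d f x) by apply: diff_continuous.
have E : g \o shift x = cst (g x) + 'd f x +o_ 0 id.
  apply/eqaddoP => e e0.
  have /eqaddoP/(_ e e0) H := diff_locally df.
  have fgx := nbhs_singleton fg.
  have fg0 : \forall h \near (0 : V), f (h + x) = g (h + x).
    move: fg; rewrite [X in X -> _](near_shift 0 x).
    by apply: filterS => y /=; rewrite subr0.
  near=> h.
  have -> : (g \o shift x - (cst (g x) + 'd f x)) h =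
            (f \o shift x - (cst (f x) + 'd f x)) h.
    rewrite !fctE /= fgx; congr (_ - _).
    by rewrite (near fg0 h).
  by near: h.
by apply/diff_locallyP; rewrite (diff_unique dc E).
Unshelve. all: by end_near. Qed.

Variable U : set V.

(** Counting the order of differentiation, instead of quantifying over lists of
    directions, lets the product and quotient rules be iterated by induction. *)
Fixpoint diff_order W (k : nat) (f : V -> W) : Prop :=
  (forall x, U x -> differentiable f x) /\
  (if k is j.+1 then forall v, diff_order j ('D_v f) else True).

Lemma diff_orderW W k (f : V -> W) : diff_order k.+1 f -> diff_order k f.
Proof.
elim: k f => [|k IH] f [df Df]; first by split.
by split=> // v; apply: IH.
Qed.

Lemma smooth_onP W (f : V -> W) :
  smooth_on U f <-> forall k, diff_order k f.
Proof.
have rc vs v (h : V -> W) :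
    iter_derive (rcons vs v) h = iter_derive vs ('D_v h).
  by elim: vs => //= w vs IH; apply/funext => x; rewrite IH.
split=> [sf k | H vs x Ux].
- elim: k f sf => [|k IH] f sf; split=> //.
  + by move=> x; exact: (sf [::]).
  + by move=> x; exact: (sf [::]).
  + by move=> v; apply: IH => vs x Ux; rewrite -rc; exact: sf.
- elim/last_ind: vs f H => [|vs v IH] f H.
    by have [df _] := H 0%N; apply: df.
  by rewrite rc; apply: IH => k; have [_] := H k.+1; apply.
Qed.

Hypothesis oU : open U.

Lemma near_eq_on W (f g : V -> W) x : {in U, f =1 g} -> U x -> {near x, f =1 g}.
Proof.
move=> fg Ux; have : nbhs x U by exact: open_nbhs_nbhs.
by apply: filterS => y Uy; apply: fg; rewrite inE.
Qed.

Lemma derive_eq_on W (f g : V -> W) v : {in U, f =1 g} -> {in U, 'D_v f =1 'D_v g}.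
Proof.
by move=> fg x; rewrite inE => Ux; apply/near_eq_derive/near_eq_on.
Qed.

Lemma diff_order_eq_on W k (f g : V -> W) :
  {in U, f =1 g} -> diff_order k f -> diff_order k g.
Proof.
elim: k f g => [|k IH] f g fg [df Df]; split=> //.
- by move=> x Ux; apply/near_eq_differentiable/(df _ Ux)/near_eq_on.
- by move=> x Ux; apply/near_eq_differentiable/(df _ Ux)/near_eq_on.
- by move=> v; apply: IH (Df v); exact: derive_eq_on.
Qed.

Lemma diff_order_cst W k (c : W) : diff_order k (cst c).
Proof.
elim: k c => [|k IH] c; split=> // v.
by rewrite (_ : 'D_v (cst c) = cst 0) //; apply/funext => x; exact: derive_cst.
Qed.

Lemma diff_orderD W k (f g : V -> W) :
  diff_order k f -> diff_order k g -> diff_order k (f \+ g).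
Proof.
elim: k f g => [|k IH] f g [df Df] [dg Dg]; split=> //.
- by move=> x Ux; apply: differentiableD; [exact: df|exact: dg].
- by move=> x Ux; apply: differentiableD; [exact: df|exact: dg].
- move=> v; apply: diff_order_eq_on (IH _ _ (Df v) (Dg v)) => x; rewrite inE => Ux.
  by rewrite /= -deriveD//; apply: diff_derivable; [exact: df|exact: dg].
Qed.

Lemma diff_orderM k (f g : V -> R) :
  diff_order k f -> diff_order k g -> diff_order k (f \* g).
Proof.
elim: k f g => [|k IH] f g [df Df] [dg Dg]; split=> //.
- by move=> x Ux; apply: differentiableM; [exact: df|exact: dg].
- by move=> x Ux; apply: differentiableM; [exact: df|exact: dg].
- move=> v.
  have H1 := IH _ _ (diff_orderW (conj df Df : diff_order k.+1 f)) (Dg v).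
  have H2 := IH _ _ (diff_orderW (conj dg Dg : diff_order k.+1 g)) (Df v).
  apply: diff_order_eq_on (diff_orderD H1 H2) => x; rewrite inE => Ux.
  by rewrite /= [RHS]deriveM//; apply: diff_derivable; [exact: df|exact: dg].
Qed.

(** $D_v(1/f) = -(1/f)^2 D_v f$ contains $1/f$ itself, one order lower. *)
Lemma diff_orderV k (f : V -> R) : (forall x, U x -> f x != 0) ->
  diff_order k f -> diff_order k (fun x => (f x)^-1).
Proof.
move=> f0; elim: k => [|k IH] [df Df]; split=> //.
- by move=> x Ux; apply: differentiableV; [exact: df|exact: f0].
- by move=> x Ux; apply: differentiableV; [exact: df|exact: f0].
- move=> v; have H := IH (diff_orderW (conj df Df : diff_order k.+1 f)).
  have H2 := diff_orderM (diff_orderM H H)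
     (diff_orderM (@diff_order_cst R k (-1)) (Df v)).
  apply: diff_order_eq_on H2 => x; rewrite inE => Ux.
  rewrite [RHS]deriveV; [|exact: f0|by apply/diff_derivable/df].
  rewrite /= mulN1r mulrN.
  by rewrite -mulNr -expr2 exprVn.
Qed.

Lemma smooth_on_derive W (f : V -> W) v : smooth_on U f -> smooth_on U ('D_v f).
Proof.
by move=> /smooth_onP H; apply/smooth_onP => k; have [_] := H k.+1; apply.
Qed.

Lemma smooth_on_differentiable W (f : V -> W) x :
  smooth_on U f -> U x -> differentiable f x.
Proof. by move=> H; exact: (H [::]). Qed.

Lemma smooth_on_eq W (f g : V -> W) :
  {in U, f =1 g} -> smooth_on U f -> smooth_on U g.
Proof.
by move=> fg /smooth_onP H; apply/smooth_onP => k; exact: diff_order_eq_on (H k).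
Qed.

Lemma smooth_on_cst W (c : W) : smooth_on U (cst c).
Proof. by apply/smooth_onP => k; exact: diff_order_cst. Qed.

Lemma smooth_onD W (f g : V -> W) :
  smooth_on U f -> smooth_on U g -> smooth_on U (f \+ g).
Proof.
by move=> /smooth_onP H /smooth_onP K; apply/smooth_onP => k; exact: diff_orderD.
Qed.

Lemma smooth_onM (f g : V -> R) :
  smooth_on U f -> smooth_on U g -> smooth_on U (f \* g).
Proof.
by move=> /smooth_onP H /smooth_onP K; apply/smooth_onP => k; exact: diff_orderM.
Qed.

Lemma smooth_onV (f : V -> R) : (forall x, U x -> f x != 0) ->
  smooth_on U f -> smooth_on U (fun x => (f x)^-1).
Proof.
by move=> f0 /smooth_onP H; apply/smooth_onP => k; exact: diff_orderV.
Qed.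

Lemma smooth_on_sum W (I : finType) (P : pred I) (f : I -> V -> W) :
  (forall i, smooth_on U (f i)) ->
  smooth_on U (fun x => \sum_(i | P i) f i x).
Proof.
move=> sf; rewrite unlock; elim: (index_enum I) => [|i s IH] /=.
  exact: smooth_on_cst.
by case: (P i) => //; exact: smooth_onD.
Qed.

Lemma smooth_on_prod (I : finType) (P : pred I) (f : I -> V -> R) :
  (forall i, smooth_on U (f i)) ->
  smooth_on U (fun x => \prod_(i | P i) f i x).
Proof.
move=> sf; rewrite unlock; elim: (index_enum I) => [|i s IH] /=.
  exact: smooth_on_cst.
by case: (P i) => //; exact: smooth_onM.
Qed.

Lemma differentiable_mx p q (f : V -> 'M[R]_(p, q)) x :
  (forall i j, differentiable (fun y => f y i j) x) -> differentiable f x.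
Proof.
move=> H.
have -> : f = \sum_i \sum_j (fun y => f y i j *: delta_mx i j).
  apply/funext => y; rewrite [LHS]matrix_sum_delta fct_sumE.
  by apply: eq_bigr => i _; rewrite fct_sumE.
do 2 (apply: differentiable_sum => ?).
exact: differentiableZl.
Qed.

Lemma derive_mxE p q (f : V -> 'M[R]_(p, q)) v x i j :
  differentiable f x -> ('D_v f x) i j = 'D_v (fun y => f y i j) x.
Proof. by move=> df; rewrite derive_mx ?mxE//; exact: diff_derivable. Qed.

Lemma differentiable_entry p q (f : V -> 'M[R]_(p, q)) x i j :
  differentiable f x -> differentiable (fun y => f y i j) x.
Proof.
move=> df; apply: (@differentiable_comp _ _ _ _ f (fun N : 'M[R]_(p, q) => N i j)) => //.
exact: differentiable_coord.
Qed.

Lemma diff_order_mx p q k (f : V -> 'M[R]_(p, q)) :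
  diff_order k f <-> forall i j, diff_order k (fun y => f y i j).
Proof.
elim: k f => [|k IH] f; split.
- by move=> [df _] i j; split=> // x Ux; apply/differentiable_entry/df.
- move=> H; split=> // x Ux; apply: differentiable_mx => i j.
  by have [df _] := H i j; exact: df.
- move=> [df Df] i j; split=> [x Ux|v]; first by apply/differentiable_entry/df.
  apply: diff_order_eq_on ((IH _).1 (Df v) i j) => x; rewrite inE => Ux.
  by rewrite derive_mxE//; exact: df.
- move=> H; have df x : U x -> differentiable f x.
    move=> Ux; apply: differentiable_mx => i j.
    by have [df _] := H i j; exact: df.
  split=> // v; apply/IH => i j; have [_ /(_ v) Df] := H i j.
  apply: diff_order_eq_on Df => x; rewrite inE => Ux.
  by rewrite derive_mxE//; exact: df.
Qed.

Lemma smooth_on_mx p q (f : V -> 'M[R]_(p, q)) :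
  smooth_on U f <-> forall i j, smooth_on U (fun y => f y i j).
Proof.
split=> [/smooth_onP H i j | H].
  by apply/smooth_onP => k; exact: ((diff_order_mx _ _).1 (H k)).
by apply/smooth_onP => k; apply/diff_order_mx => i j; move/smooth_onP: (H i j).
Qed.

Lemma smooth_on_det p (f : V -> 'M[R]_p) :
  smooth_on U f -> smooth_on U (fun y => \det (f y)).
Proof.
move=> /smooth_on_mx sf.
apply: smooth_on_sum => s; apply: smooth_onM; first exact: smooth_on_cst.
exact: smooth_on_prod.
Qed.

(** By Cramer's rule the entries of the inverse are minors over the
    determinant. *)
Lemma smooth_on_invmx p (f : V -> 'M[R]_p) :
  (forall x, U x -> f x \in unitmx) ->
  smooth_on U f -> smooth_on U (fun y => invmx (f y)).
Proof.
move=> fu sf; apply/smooth_on_mx => i j.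
have sdet := smooth_on_det sf.
have sinv : smooth_on U (fun y => (\det (f y))^-1).
  by apply: smooth_onV sdet => x /fu; rewrite unitmxE unitfE.
have sadj : smooth_on U (fun y => \adj (f y) i j).
  apply: (@smooth_on_eq _ (fun y => (-1) ^+ (j + i) * \det (row' j (col' i (f y))))).
    by move=> x _; rewrite mxE.
  apply: smooth_onM; first exact: smooth_on_cst.
  apply: smooth_on_det; apply/smooth_on_mx => a b.
  move/smooth_on_mx : sf => /(_ (lift j a) (lift i b)).
  by apply: smooth_on_eq => x _; rewrite !mxE.
apply: smooth_on_eq (smooth_onM sinv sadj) => x; rewrite inE => Ux.
by rewrite /invmx fu//= !mxE.
Qed.

Lemma derive_comm p q (f : V -> 'M[R]_(p, q)) v w x :
  smooth_on U f -> U x -> 'D_v ('D_w f) x = 'D_w ('D_v f) x.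
Proof.
move=> sf Ux; apply/matrixP => i j.
have nU : nbhs x U by exact: open_nbhs_nbhs.
have sD u := smooth_on_derive u sf.
have E u u' : ('D_u ('D_u' f) x) i j = 'D_u ('D_u' (fun y => f y i j)) x.
  rewrite derive_mxE; last exact: smooth_on_differentiable.
  apply: near_eq_derive; near=> y; apply: derive_mxE.
  by apply: smooth_on_differentiable sf _; near: y.
have /smooth_on_mx/(_ i j) se := sf.
apply: (etrans (E v w)); apply: (etrans _ (esym (E w v))).
apply: (@derive_schwarz R V (fun y => f y i j)).

- near=> y; apply: smooth_on_differentiable se _; near: y; exact: nU.
- exact: smooth_on_differentiable (smooth_on_derive _ se) Ux.
- exact: smooth_on_differentiable (smooth_on_derive _ se) Ux.
Unshelve. all: by end_near. Qed.

End Smooth.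

(** * Endomorphisms whose square is a scalar *)

(** A full-rank factorization $P = CR$ of an idempotent satisfies $RC = 1$. *)
Lemma idempotent_trace (F : fieldType) (m : nat) (P : 'M[F]_m) :
  P *m P = P -> \tr P = (\rank P)%:R.
Proof.
move=> PP.
have H : col_base P *m (row_base P *m col_base P) *m row_base P =
         col_base P *m 1%:M *m row_base P.
  by rewrite mulmxA mulmx_base mulmx1 -mulmxA mulmx_base PP.
have E : row_base P *m col_base P = 1%:M.
  exact: row_full_inj (col_base_full P) _ _ (row_free_inj (row_base_free P) H).
by rewrite -{1}(mulmx_base P) mxtrace_mulC E mxtrace1.
Qed.

Section SquareScalar.
Variables (F : numFieldType) (m : nat).
Implicit Types A P : 'M[F]_m.

(** The row space of the idempotent $(A + h)/2h$ is the eigenspace of $h$. *)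
Lemma rank_eigenspace_square_scalar A (h : F) : h != 0 ->
  A *m A = (h ^+ 2)%:M ->
  (\rank (eigenspace A h))%:R = (2 * h)^-1 * (\tr A + h * m%:R).
Proof.
move=> h0 AA; pose P := (2 * h)^-1 *: (A + h%:M).
have h20 : 2 * h != 0 by rewrite mulf_neq0// pnatr_eq0.
have PA : P *m (A - h%:M) = 0.
  rewrite -scalemxAl mulmxDl !mulmxBr AA -scalar_mxM -expr2.
  by rewrite mul_mx_scalar mul_scalar_mx addrA subrK subrr scaler0.
have KP : kermx (A - h%:M) *m P = kermx (A - h%:M).
  have /eqP := mulmx_ker (A - h%:M); rewrite mulmxBr subr_eq0 => /eqP KA.
  rewrite -scalemxAr mulmxDr KA -mulmxDr -raddfD/= (_ : h + h = 2 * h); last by ring.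
  by rewrite mul_mx_scalar scalerA mulVf// scale1r.
have PP : P *m P = P.
  apply/eqP; rewrite -subr_eq0; apply/eqP.
  have -> : P *m P - P = (2 * h)^-1 *: (P *m (A - h%:M)).
    rewrite -[X in _ - X]mulmx1 -mulmxBr scalemxAr; congr (_ *m _).
    rewrite -[1%:M](scalerK h20) -scalerBr; congr (_ *: _).
    rewrite scale_scalar_mx mulr1 mulr_natl mulr2n raddfD/=.
    by rewrite opprD addrA addrK.
  by rewrite PA scaler0.
have -> : \rank (eigenspace A h) = \rank P.
  apply/eqP; rewrite eqn_leq !mxrankS//; first by apply/sub_kermxP.
  by rewrite /eigenspace -KP submxMl.
by rewrite -idempotent_trace// linearZ/= linearD/= mxtrace_scalar mulr_natr.
Qed.

Lemma eigenvalue_square_scalar A (h a : F) : A *m A = (h ^+ 2)%:M ->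
  eigenvalue A a -> a = h \/ a = - h.
Proof.
move=> AA /eigenvalueP[v vA v0].
have : (a ^+ 2 - h ^+ 2) *: v = 0.
  rewrite scalerBl -[h ^+ 2 *: v]mul_mx_scalar -AA mulmxA !(vA, =^~ scalemxAl).
  by rewrite scalerA -expr2 subrr.
move/eqP; rewrite scaler_eq0 (negPf v0) orbF subr_eq0 eqf_sqr.
by case/orP => /eqP; [left|right].
Qed.

End SquareScalar.

(** * Inner products and the curvature of the sphere *)

Section DotAlgebra.
Context {R : realType} {k : nat}.
Implicit Types (v w x : 'rV[R]_k) (a : R).

Lemma dotC v w : dot v w = dot w v.
Proof. by apply: eq_bigr => i _; rewrite mulrC. Qed.

Lemma dotDl v w x : dot (v + w) x = dot v x + dot w x.
Proof. by rewrite -big_split; apply: eq_bigr => i _; rewrite mxE mulrDl. Qed.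

Lemma dotZl a v w : dot (a *: v) w = a * dot v w.
Proof. by rewrite mulr_sumr; apply: eq_bigr => i _; rewrite mxE mulrA. Qed.

Lemma dotNl v w : dot (- v) w = - dot v w.
Proof. by rewrite -scaleN1r dotZl mulN1r. Qed.

Lemma dotBl v w x : dot (v - w) x = dot v x - dot w x.
Proof. by rewrite dotDl dotNl. Qed.

Lemma dot0l v : dot 0 v = 0.
Proof. by rewrite -(scale0r 0) dotZl mul0r. Qed.

Lemma dotZr a v w : dot w (a *: v) = a * dot w v.
Proof. by rewrite !(dotC w) dotZl. Qed.

Lemma dotNr v w : dot w (- v) = - dot w v.
Proof. by rewrite !(dotC w) dotNl. Qed.

Lemma dotBr v w x : dot x (v - w) = dot x v - dot x w.
Proof. by rewrite !(dotC x) dotBl. Qed.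

Lemma dot0r v : dot v 0 = 0.
Proof. by rewrite dotC dot0l. Qed.

Lemma dot_suml (I : finType) (P : pred I) (f : I -> 'rV[R]_k) w :
  dot (\sum_(i | P i) f i) w = \sum_(i | P i) dot (f i) w.
Proof.
by elim/big_rec2: _ => [|i a b _ <-]; rewrite ?dot0l ?dotDl.
Qed.

Lemma dot_sumr (I : finType) (P : pred I) (f : I -> 'rV[R]_k) w :
  dot w (\sum_(i | P i) f i) = \sum_(i | P i) dot w (f i).
Proof. by rewrite dotC dot_suml; apply: eq_bigr => i _; rewrite dotC. Qed.

Lemma dot_eq0 v : dot v v = 0 -> v = 0.
Proof.
move=> /eqP; rewrite psumr_eq0; last by move=> i _; rewrite -expr2 sqr_ge0.
move=> /allP H; apply/rowP => i; have := H i (mem_index_enum _).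
by rewrite -expr2 sqrf_eq0 mxE => /eqP.
Qed.

End DotAlgebra.

Section DotCalculus.
Context {R : realType} {V : normedModType R}.

Lemma differentiable_dot k (a b : V -> 'rV[R]_k) x :
  differentiable a x -> differentiable b x ->
  differentiable (fun y => dot (a y) (b y)) x.
Proof.
move=> da db.
rewrite (_ : (fun y => _) = \sum_i (fun y => a y 0 i * b y 0 i)); last first.
  by apply/funext => y; rewrite fct_sumE.
apply: differentiable_sum => i.
by apply: differentiableM; exact: differentiable_entry.
Qed.

Lemma derive_dot k (a b : V -> 'rV[R]_k) v x :
  differentiable a x -> differentiable b x ->
  'D_v (fun y => dot (a y) (b y)) x = dot ('D_v a x) (b x) + dot (a x) ('D_v b x).
Proof.
move=> da db.
have dM i : differentiable (fun y => a y 0 i * b y 0 i) x.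
  by apply: differentiableM; exact: differentiable_entry.
rewrite (_ : (fun y => _) = \sum_i (fun y => a y 0 i * b y 0 i)); last first.
  by apply/funext => y; rewrite fct_sumE.
rewrite derive_sum; last by move=> i; apply: diff_derivable.
rewrite /dot -big_split/=; apply: eq_bigr => i _.
rewrite deriveM; try by apply/diff_derivable/differentiable_entry.
by rewrite -!derive_mxE// addrC mulrC; congr (_ + _); rewrite mulrC.
Qed.

Lemma differentiable_scale k (c : V -> R) (b : V -> 'rV[R]_k) x :
  differentiable c x -> differentiable b x ->
  differentiable (fun y => c y *: b y) x.
Proof.
move=> dc db; apply: differentiable_mx => i j.
rewrite (_ : (fun y => _) = (fun y => c y * b y i j)); last first.
  by apply/funext => y; rewrite mxE.
by apply: differentiableM => //; exact: differentiable_entry.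
Qed.

Lemma derive_scale k (c : V -> R) (b : V -> 'rV[R]_k) v x :
  differentiable c x -> differentiable b x ->
  'D_v (fun y => c y *: b y) x = 'D_v c x *: b x + c x *: 'D_v b x.
Proof.
move=> dc db; apply/rowP => i; rewrite derive_mxE; last exact: differentiable_scale.
rewrite (_ : (fun y => _) = (fun y => c y * b y 0 i)); last first.
  by apply/funext => y; rewrite mxE.
have db' : differentiable (fun y => b y 0 i) x by exact: differentiable_entry.
rewrite deriveM; try exact: diff_derivable.
by rewrite !mxE derive_mxE// [LHS]addrC; congr (_ + _); exact: mulrC.
Qed.

Lemma derive_sumE (W : normedModType R) (I : finType) (h : I -> V -> W) v x :
  (forall i, differentiable (h i) x) ->
  'D_v (fun y => \sum_i h i y) x = \sum_i 'D_v (h i) x.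
Proof.
move=> dh.
have [D E] : differentiable (fun y => \sum_i h i y) x /\
    'D_v (fun y => \sum_i h i y) x = \sum_i 'D_v (h i) x.
  rewrite unlock; elim: (index_enum I) => [|i s [D IH]] /=.
    by split; [exact: differentiable_cst|exact: derive_cst].
  split; first exact: differentiableD.
  by rewrite -IH -deriveD//; exact: diff_derivable.
exact: E.
Qed.

Lemma derive_dir m (W : normedModType R) (f : 'rV[R]_m -> W) x v :
  differentiable f x -> 'D_v f x = \sum_i v 0 i *: 'D_(basis_vec R i) f x.
Proof.
move=> df; rewrite deriveE// {1}(row_sum_delta v) linear_sum.
by apply: eq_bigr => i _; rewrite linearZ/= deriveE.
Qed.

Variable U : set V.
Hypothesis oU : open U.

Lemma smooth_on_dot k (a b : V -> 'rV[R]_k) :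
  smooth_on U a -> smooth_on U b -> smooth_on U (fun y => dot (a y) (b y)).
Proof.
move=> /(smooth_on_mx oU) sa /(smooth_on_mx oU) sb.
by apply: smooth_on_sum => // i; exact: smooth_onM.
Qed.

Lemma smooth_on_scale k (c : V -> R) (b : V -> 'rV[R]_k) :
  smooth_on U c -> smooth_on U b -> smooth_on U (fun y => c y *: b y).
Proof.
move=> sc /(smooth_on_mx oU) sb; apply/(smooth_on_mx oU) => i j.
apply: (@smooth_on_eq _ _ _ oU _ (fun y => c y * b y i j)).
  by move=> y _; rewrite mxE.
exact: smooth_onM.
Qed.

End DotCalculus.

Section SphereCurvature.
Context {R : realType} {n : nat}.
Local Notation F := 'rV[R]_n.+1.
Implicit Types a b c h x y : F.

Lemma tprojE x a : dot a x = 0 -> tproj x a = a.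
Proof. by move=> ax; rewrite /tproj ax scale0r subr0. Qed.

Lemma tprojD x a b : tproj x (a + b) = tproj x a + tproj x b.
Proof. by rewrite /tproj dotDl scalerDl opprD addrACA. Qed.

Lemma tprojZ x (t : R) a : tproj x (t *: a) = t *: tproj x a.
Proof. by rewrite /tproj dotZl scalerBr scalerA. Qed.

Lemma tprojN x a : tproj x (- a) = - tproj x a.
Proof. by rewrite -scaleN1r tprojZ scaleN1r. Qed.

Lemma tproj_radial x : dot x x = 1 -> tproj x x = 0.
Proof. by move=> xx; rewrite /tproj xx scale1r subrr. Qed.

Lemma tproj0 x : tproj x 0 = 0.
Proof. by rewrite -(scale0r x) tprojZ !scale0r. Qed.

Lemma differentiable_tproj (Z : F -> F) x :
  differentiable Z x -> differentiable (fun y => tproj y (Z y)) x.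
Proof.
move=> dZ; apply: differentiableB => //; apply: differentiable_scale => //.
exact: differentiable_dot.
Qed.

Lemma derive_tproj (Z : F -> F) h x : differentiable Z x ->
  'D_h (fun y => tproj y (Z y)) x =
  'D_h Z x - (dot ('D_h Z x) x + dot (Z x) h) *: x - dot (Z x) x *: h.
Proof.
move=> dZ; have did : differentiable (id : F -> F) x by [].
have dd : differentiable (fun y => dot (Z y) y) x by exact: differentiable_dot.
rewrite deriveB; first last.
- exact/diff_derivable/differentiable_scale.
- exact: diff_derivable.
rewrite derive_scale// derive_dot// derive_id.
by rewrite opprD addrA.
Qed.

(** Projecting $Z$ before differentiating only adds $-\langle Z, x\rangle X$: the
    derivative of $y \mapsto y$ along $X$ is $X$, and radial terms are projected
    away. *)
Lemma sphere_conn_tproj (X Z : F -> F) x : dot x x = 1 -> dot (X x) x = 0 ->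
  differentiable Z x ->
  sphere_conn X (fun y => tproj y (Z y)) x =
  tproj x ('D_(X x) Z x) - dot (Z x) x *: X x.
Proof.
move=> xx Xx dZ; rewrite /sphere_conn derive_tproj// !(tprojD, tprojN, tprojZ).
by rewrite tproj_radial// scaler0 oppr0 addr0 (tprojE Xx).
Qed.

Lemma derive_tproj_cst b h x :
  'D_h (tproj^~ b) x = - (dot b h *: x + dot b x *: h).
Proof.
rewrite (derive_tproj (Z := cst b))// derive_cst dot0l !add0r.
by rewrite -opprD.
Qed.

Lemma sphere_conn2 a b c x : dot x x = 1 -> dot a x = 0 -> dot b x = 0 ->
  dot c x = 0 ->
  sphere_conn (tproj^~ a) (sphere_conn (tproj^~ b) (tproj^~ c)) x
  = - dot c a *: b.
Proof.
move=> xx ax bx cx.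
pose Z y := - (dot c (tproj y b) *: y + dot c y *: tproj y b).
have -> : sphere_conn (tproj^~ b) (tproj^~ c) = fun y => tproj y (Z y).
  by apply/funext => y; rewrite /sphere_conn derive_tproj_cst.
have did : differentiable (id : F -> F) x by [].
have dc : differentiable (cst c) x by [].
have db : differentiable (tproj^~ b) x.
  exact: (differentiable_tproj (Z := cst b)).
have d1 : differentiable (fun y => dot c (tproj y b)) x.
  exact: (differentiable_dot (a := cst c)).
have d2 : differentiable (fun y => dot c y) x.
  exact: (differentiable_dot (a := cst c)).
have d3 := differentiable_scale d1 did.
have d4 := differentiable_scale d2 db.
have dZ : differentiable Z x by exact/differentiableN/differentiableD.
have Dc : 'D_a (fun y => dot c y) x = dot c a.
  by rewrite (derive_dot (a := cst c) (b := id))// derive_cst dot0l add0r derive_id.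
rewrite sphere_conn_tproj ?(tprojE ax)// /Z.
rewrite deriveN; last exact/diff_derivable/differentiableD.
rewrite deriveD; try exact: diff_derivable.
rewrite (derive_scale _ d1 did) (derive_scale _ d2 db) derive_id.
rewrite Dc.
rewrite !(tprojE bx) cx !scale0r !addr0.
rewrite !(tprojN, tprojD, tprojZ) tproj_radial// scaler0 add0r.
rewrite (tprojE ax) (tprojE bx) dotNl dotZl xx mulr1 scaleNr opprK opprD.
rewrite addrAC addNr add0r.
by rewrite scaleNr.
Qed.

(** The unit sphere has constant sectional curvature 1. *)
Lemma sphere_curvE a b c x : dot x x = 1 -> dot a x = 0 -> dot b x = 0 ->
  dot c x = 0 ->
  sphere_curv x a b c = dot b c *: a - dot a c *: b.
Proof.
move=> xx ax bx cx; rewrite /sphere_curv /sphere_curv_fields !sphere_conn2//.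
have -> : sphere_conn (bracket (tproj^~ a) (tproj^~ b)) (tproj^~ c) x = 0.
  rewrite /sphere_conn /bracket (tprojE ax) (tprojE bx) !derive_tproj_cst.
  rewrite ax bx !scale0r !addr0 (dotC a b) subrr dot0r scale0r scaler0 addr0.
  by rewrite oppr0 tproj0.
rewrite subr0 (dotC c a) (dotC c b).
by rewrite !scaleNr opprK addrC.
Qed.

End SphereCurvature.

(** * Pointwise algebra *)

Lemma sum_delta (R : pzRingType) (V : lmodType R) (m : nat) (x : 'I_m -> V) l :
  \sum_i (i == l)%:R *: x i = x l.
Proof.
rewrite (bigD1 l)//= eqxx scale1r big1 ?addr0// => i /negPf ->.
by rewrite scale0r.
Qed.

Lemma sum_deltar (R : pzRingType) (m : nat) (x : 'I_m -> R) l :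
  \sum_i (i == l)%:R * x i = x l.
Proof. exact: (@sum_delta R R^o). Qed.

Lemma basis_vec_mul (R : realType) m p k (B : 'M[R]_(m, p)) l :
  (basis_vec R k *m B) 0 l = B k l.
Proof. by rewrite -rowE mxE. Qed.

Lemma basis_vecE (R : realType) m k l : @basis_vec R m k 0 l = (l == k)%:R.
Proof. by rewrite mxE eqxx. Qed.

(** In the trace over $p = i$ the two terms on the right-hand side of the
    hypothesis become equal, because $A$ is self-adjoint for $g$. *)
Lemma gauss_contraction (R : realType) (m k : nat) (g A : 'M[R]_m)
    (N T : 'I_m -> 'I_m -> 'rV[R]_k) :
  g^T = g -> (g *m A)^T = g *m A ->
  (forall p i, T p i = \sum_l A i l *: N p l) ->
  (forall p i, N p i = N i p) -> (forall p i, T p i = T i p) ->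
  (forall p q i r, dot (T p i) (N q r) - dot (N p i) (T q r) =
                   dot (T q i) (N p r) - dot (N q i) (T p r)) ->
  forall q r, dot (\sum_p \sum_i g p i *: T p i) (N q r) =
              dot (\sum_p \sum_i g p i *: N p i) (T q r).
Proof.
move=> gT CT TE NC TC K q r.
have gC p i : g p i = g i p by rewrite -{1}gT mxE.
have CC p i : (g *m A) p i = (g *m A) i p by rewrite -{1}CT mxE.
have L : \sum_p \sum_i g p i * dot (T q i) (N p r)
    = \sum_p \sum_l (g *m A) p l * dot (N q l) (N p r).
  apply: eq_bigr => p _.
  under eq_bigr => i _ do rewrite TE dot_suml mulr_sumr.
  rewrite exchange_big; apply: eq_bigr => l _ /=.
  by rewrite mxE mulr_suml; apply: eq_bigr => i _; rewrite dotZl mulrA.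
have L' : \sum_p \sum_i g p i * dot (N q i) (T p r)
    = \sum_p \sum_l (g *m A) p l * dot (N q l) (N p r).
  rewrite exchange_big [RHS]exchange_big; apply: eq_bigr => i _ /=.
  under eq_bigr => p _ do rewrite TC TE dot_sumr mulr_sumr.
  rewrite exchange_big; apply: eq_bigr => l _ /=.
  rewrite CC mxE mulr_suml; apply: eq_bigr => p _.
  by rewrite dotZr gC mulrA (NC r l).
apply/eqP; rewrite -subr_eq0 !dot_suml -sumrB; apply/eqP.
transitivity (\sum_p \sum_i (g p i * dot (T q i) (N p r) - g p i * dot (N q i) (T p r))).
  apply: eq_bigr => p _; rewrite !dot_suml -sumrB; apply: eq_bigr => i _.
  by rewrite !dotZl -!mulrBr K.
under eq_bigr => p _ do rewrite sumrB.
by rewrite sumrB L L' subrr.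
Qed.

(** The matrix hypothesis says that $A$ is self-adjoint for the form $g$. *)
Lemma selfadjoint_sum (R : comPzRingType) (m : nat) (g A : 'M[R]_m)
    (y z : 'I_m -> R) :
  (g *m A)^T = g *m A -> g^T = g ->
  \sum_i \sum_j g i j * (- \sum_l A i l * y l) * z j =
  \sum_i \sum_j g i j * y i * (- \sum_l A j l * z l).
Proof.
move=> CT gT.
have gC p i : g p i = g i p by rewrite -{1}gT mxE.
have CC p i : (g *m A) p i = (g *m A) i p by rewrite -{1}CT mxE.
transitivity (- \sum_i \sum_l (g *m A) i l * y l * z i).
  rewrite exchange_big -sumrN; apply: eq_bigr => j _ /=.
  under eq_bigr => i _ do rewrite mulrN mulNr mulr_sumr mulr_suml gC.
  rewrite sumrN exchange_big; congr (- _); apply: eq_bigr => l _ /=.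
  by rewrite mxE -mulrA mulr_suml; apply: eq_bigr => i _; rewrite !mulrA gC.
rewrite exchange_big -sumrN; apply: eq_bigr => i _ /=.
under [RHS]eq_bigr => j _ do rewrite mulrN mulr_sumr.
rewrite [RHS]sumrN [in RHS]exchange_big; congr (- _); apply: eq_bigr => l _ /=.
rewrite CC mxE !mulr_suml; apply: eq_bigr => j _.
by rewrite -!mulrA; congr (_ * _); rewrite mulrCA.
Qed.

(* Unification is to treat these operations as atoms. *)
Opaque derive basis_vec dot.

(* Linear consequences of a few equations between large expressions. *)
Lemma cancel_common (R : realFieldType) (a b c d c' d' t1 t2 : R) :
  a = c + t1 -> b = d + t2 -> t1 = t2 -> c = - c' -> d = - d' ->
  a - b = d' - c'.
Proof. by move=> -> -> -> -> ->; ring. Qed.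

Lemma opposite_differences (R : realFieldType) (a b c d s t : R) :
  s = b - a -> t = d - c -> s = t -> a - b = c - d.
Proof. by move=> -> -> ?; lra. Qed.

Lemma equal_of_sub0 (R : zmodType) (a b c d : R) :
  a - b = 0 -> a = c -> b = d -> c = d.
Proof. by move=> /eqP; rewrite subr_eq0 => /eqP -> -> ->. Qed.

Lemma cancel_first (R : realFieldType) (a1 a2 a3 a4 b1 b2 b3 b4 : R) :
  a1 + a2 = a3 + a4 -> b1 + b2 = b3 + b4 -> a1 = b1 -> a3 = b3 ->
  a2 - a4 = b2 - b4.
Proof. by move=> *; lra. Qed.

(** * Immersed patches in the Euclidean space *)

Section Patch.
Context {R : realType} {m n : nat}.
Local Notation E := 'rV[R]_m.
Local Notation F := 'rV[R]_n.+1.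
Local Notation e := (@basis_vec R m).
Local Notation "''d_' i g" := ('D_(e i) g) (at level 10, i, g at next level).
Local Notation "''d_' i g u" := ('D_(e i) g u)
  (at level 10, i, g, u at next level).
Variables (f : E -> F) (U : set E).
Hypothesis oU : open U.
Hypothesis sf : smooth_on U f.
Hypothesis immersed : forall u, U u -> forall v, v != 0 -> 'D_v f u != 0.
Local Notation G := (induced_metric f).
Local Notation gi u := (invmx (G u)).

Lemma map_differentiable u : U u -> differentiable f u.
Proof. exact: smooth_on_differentiable. Qed.

Lemma smooth_derive i : smooth_on U ('d_ i f).
Proof. exact: smooth_on_derive. Qed.

Lemma smooth_derive2 i j : smooth_on U ('d_ i ('d_ j f)).
Proof. exact/smooth_on_derive/smooth_derive. Qed.

Lemma derive2C i j u : U u -> 'd_ i ('d_ j f) u = 'd_ j ('d_ i f) u :> F.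
Proof. by move=> Uu; apply: (derive_comm oU). Qed.

Lemma metricE u i j : G u i j = dot ('d_ i f u) ('d_ j f u).
Proof. by rewrite mxE. Qed.

Lemma metricC u i j : G u i j = G u j i.
Proof.
by apply: (etrans (metricE u i j)); apply: (etrans (dotC _ _)); rewrite mxE.
Qed.

Lemma tr_metric u : (G u)^T = G u.
Proof. by apply/matrixP => i j; rewrite mxE metricC. Qed.

(** A vector in the kernel of the Gram matrix is orthogonal to itself in the
    image of $df$, which is injective. *)
Lemma metric_unit u : U u -> G u \in unitmx.
Proof.
move=> Uu; rewrite -row_free_unit; apply: inj_row_free => v vG.
apply/eqP; apply: contraT => /(immersed Uu)/negP[]; apply/eqP/dot_eq0.
rewrite {2}(derive_dir _ (map_differentiable Uu)) dot_sumr big1// => j _.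
rewrite dotZr (derive_dir _ (map_differentiable Uu)) dot_suml.
rewrite (_ : \sum_i _ = (v *m G u) 0 j); first by rewrite vG mxE mulr0.
by rewrite mxE; apply: eq_bigr => i _; rewrite metricE dotZl.
Qed.

Lemma tr_inv_metric u : (gi u)^T = gi u.
Proof. by rewrite trmx_inv tr_metric. Qed.

Lemma inv_metricC u i j : gi u i j = gi u j i.
Proof. by rewrite -[in LHS]tr_inv_metric mxE. Qed.

Lemma inv_metric_mul u j l : U u -> \sum_i gi u j i * G u i l = (j == l)%:R.
Proof.
by move=> Uu; have /matrixP/(_ j l) := mulVmx (metric_unit Uu); rewrite !mxE.
Qed.

Lemma smooth_metric : smooth_on U G.
Proof.
apply/(smooth_on_mx oU) => i j.
apply: (smooth_on_eq oU (f := fun y => dot ('d_ i f y) ('d_ j f y))).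
  by move=> y _; rewrite mxE.
by apply: smooth_on_dot => //; exact: smooth_derive.
Qed.

Lemma smooth_inv_metric i j : smooth_on U (fun u => gi u i j).
Proof.
have := smooth_on_invmx oU metric_unit smooth_metric.
by move/(smooth_on_mx oU).
Qed.

Lemma normal_partD u w z :
  normal_part f u (w + z) = normal_part f u w + normal_part f u z.
Proof.
rewrite /normal_part addrACA -opprD; congr (_ - _).
rewrite -big_split; apply: eq_bigr => i _.
rewrite -big_split; apply: eq_bigr => j _.
by rewrite dotDl mulrDr scalerDl.
Qed.

Lemma normal_partZ u a w : normal_part f u (a *: w) = a *: normal_part f u w.
Proof.
rewrite /normal_part scalerBr; congr (_ - _).
rewrite scaler_sumr; apply: eq_bigr => i _.
rewrite scaler_sumr; apply: eq_bigr => j _.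
by rewrite dotZl scalerA mulrCA.
Qed.

Lemma normal_partN u w : normal_part f u (- w) = - normal_part f u w.
Proof. by rewrite -scaleN1r normal_partZ scaleN1r. Qed.

Lemma normal_part0 u : normal_part f u 0 = 0.
Proof. by rewrite -(scale0r 0) normal_partZ !scale0r. Qed.

Lemma normal_part_sum u (I : finType) (w : I -> F) :
  normal_part f u (\sum_i w i) = \sum_i normal_part f u (w i).
Proof.
by elim/big_rec2: _ => [|i a b _ <-]; rewrite ?normal_part0 ?normal_partD.
Qed.

Lemma normal_part_id u w : (forall l, dot w ('d_ l f u) = 0) ->
  normal_part f u w = w.
Proof.
move=> H; rewrite /normal_part big1 ?subr0// => i _.
by rewrite big1// => j _; rewrite H mulr0 scale0r.
Qed.

Lemma normal_part_d u l : U u -> normal_part f u ('d_ l f u) = 0.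
Proof.
move=> Uu; rewrite /normal_part.
under eq_bigr => i _.
  rewrite -scaler_suml.
  under eq_bigr => j _ do rewrite -metricE metricC.
  rewrite inv_metric_mul//.
  over.
by rewrite sum_delta subrr.
Qed.

Lemma dot_normal_part u w l : U u -> dot (normal_part f u w) ('d_ l f u) = 0.
Proof.
move=> Uu; rewrite /normal_part dotBl dot_suml.
under eq_bigr => i _.
  rewrite dot_suml.
  under eq_bigr => j _ do rewrite dotZl -metricE inv_metricC mulrAC.
  over.
rewrite exchange_big /=.
under eq_bigr => j _ do rewrite -mulr_suml inv_metric_mul//.
by rewrite sum_deltar subrr.
Qed.

(** Pythagoras, for the splitting into normal and tangential components. *)
Lemma normal_part_dot u w z : U u ->
  dot w z = dot (normal_part f u w) (normal_part f u z) +
    \sum_i \sum_j gi u i j * dot w ('d_ i f u) * dot z ('d_ j f u).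
Proof.
move=> Uu.
have perp x y : (forall l, dot x ('d_ l f u) = 0) ->
    dot x y = dot x (normal_part f u y).
  move=> xl; rewrite /normal_part dotBr dot_sumr big1 ?subr0// => i _.
  by rewrite dot_sumr big1// => j _; rewrite dotZr xl mulr0.
rewrite -perp; last by move=> l; exact: dot_normal_part.
rewrite -[X in dot X z](subrK (normal_part f u w)) dotDl addrC; congr (_ + _).
rewrite /normal_part opprB addrC subrK dot_suml.
rewrite [RHS]exchange_big; apply: eq_bigr => i _ /=.
rewrite dot_suml; apply: eq_bigr => j _.
by rewrite dotZl inv_metricC (dotC z).
Qed.

Lemma normal_part_dot_eq u w z w' z' : U u ->
  normal_part f u w = w' -> normal_part f u z = z' ->
  dot w z = dot w' z' +
    \sum_i \sum_j gi u i j * dot w ('d_ i f u) * dot z ('d_ j f u).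
Proof. by move=> Uu <- <-; exact: normal_part_dot. Qed.

Lemma dot_normal_partr u x w : U u -> (forall l, dot x ('d_ l f u) = 0) ->
  dot x (normal_part f u w) = dot x w.
Proof.
move=> Uu xl; rewrite /normal_part dotBr dot_sumr big1 ?subr0// => i _.
by rewrite dot_sumr big1// => j _; rewrite dotZr xl mulr0.
Qed.

Lemma smooth_normal_part (W : E -> F) :
  smooth_on U W -> smooth_on U (fun u => normal_part f u (W u)).
Proof.
move=> sW; apply: smooth_onD => //.
apply: (smooth_on_eq oU (f := fun u => \sum_i \sum_j
    (- gi u i j * dot (W u) ('d_ j f u)) *: 'd_ i f u)).
  move=> u _; rewrite -sumrN; apply: eq_bigr => i _.
  by rewrite -sumrN; apply: eq_bigr => j _; rewrite mulNr scaleNr.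
do 2 apply: smooth_on_sum => // ?.
apply: smooth_on_scale => //; last exact: smooth_derive.
apply: smooth_onM => //; last by apply: smooth_on_dot => //; exact: smooth_derive.
apply: (smooth_on_eq oU (f := fun u => (-1) * gi u _ _)).
  by move=> u _; rewrite mulN1r.
by apply: smooth_onM => //; [exact: smooth_on_cst|exact: smooth_inv_metric].
Qed.

Lemma dot_metric_trace u (b : E -> E -> F) xi :
  dot (metric_trace G u b) xi =
  \sum_i \sum_j gi u i j * dot (b (e i) (e j)) xi.
Proof.
rewrite dot_suml; apply: eq_bigr => i _.
by rewrite dot_suml; apply: eq_bigr => j _; rewrite dotZl.
Qed.

(** Koszul's formula: with the metric expanded as inner products of first
    derivatives, all but one kind of term cancel by symmetry of the second
    derivatives. *)
Lemma christoffel_dot u i j r : U u ->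
  \sum_l christoffel G u i j 0 l * G u l r
  = dot ('d_ i ('d_ j f) u) ('d_ r f u).
Proof.
move=> Uu.
have D a b c : 'd_ a (fun w => G w b c) u =
    dot ('d_ a ('d_ b f) u) ('d_ c f u) + dot ('d_ b f u) ('d_ a ('d_ c f) u).
  rewrite (_ : (fun w => _) = fun w => dot ('d_ b f w) ('d_ c f w)); last first.
    by apply/funext => w; rewrite mxE.
  by rewrite derive_dot//; apply: smooth_on_differentiable Uu; exact: smooth_derive.
have K l : 'd_ i (fun w => G w j l) u + 'd_ j (fun w => G w i l) u
     - 'd_ l (fun w => G w i j) u = 2 * dot ('d_ i ('d_ j f) u) ('d_ l f u).
  have H (x : 'I_m -> F) (x2 : 'I_m -> 'I_m -> F) : (forall a b, x2 a b = x2 b a) ->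
      dot (x2 i j) (x l) + dot (x j) (x2 i l)
      + (dot (x2 j i) (x l) + dot (x i) (x2 j l))
      - (dot (x2 l i) (x j) + dot (x i) (x2 l j)) = 2 * dot (x2 i j) (x l).
    move=> C; rewrite (C j i) (C l i) (C l j) (dotC (x j)); ring.
  apply: etrans (H (fun a => 'd_ a f u) (fun a b => 'd_ a ('d_ b f) u) _).
    by congr (_ + _ - _); exact: D.
  by move=> a b; exact: derive2C.
have half (a d g : R) : 2^-1 * (a * (2 * d) * g) = a * g * d by field.
under eq_bigr => l _.
  rewrite mxE -mulrA mulr_suml mulr_sumr.
  under eq_bigr => k _ do rewrite K half inv_metricC.
  over.
rewrite exchange_big /=.
under eq_bigr => k _ do rewrite -mulr_suml inv_metric_mul//.
exact: (sum_deltar (fun k => dot _ ('d_ k f u))).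
Qed.

Lemma levi_civita_basisl i (Y : E -> E) u :
  levi_civita G (e i) Y u = 'd_ i Y u + \sum_j Y u 0 j *: christoffel G u i j.
Proof.
rewrite /levi_civita (bigD1 i)//= [X in _ + (_ + X)]big1 ?addr0.
  by apply: (congr1 (+%R _)); apply: eq_bigr => j _; rewrite basis_vecE eqxx mul1r.
move=> k ki; rewrite big1// => l _.
by rewrite basis_vecE (negPf ki) mul0r scale0r.
Qed.

Lemma levi_civita_basis i j u :
  levi_civita G (e i) (cst (e j)) u = christoffel G u i j.
Proof.
rewrite levi_civita_basisl derive_cst add0r.
under eq_bigr => k _ do rewrite basis_vecE.
exact: sum_delta.
Qed.

(** The Levi-Civita connection of the induced metric is the tangential part of
    the flat one. *)
Lemma derive_christoffel i j u : U u ->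
  'D_(christoffel G u i j) f u =
  'd_ i ('d_ j f) u - normal_part f u ('d_ i ('d_ j f) u) :> F.
Proof.
move=> Uu; rewrite (derive_dir _ (map_differentiable Uu)) /normal_part opprB addrC subrK.
apply: eq_bigr => k _; rewrite -scaler_suml; congr (_ *: _).
under [RHS]eq_bigr => r _.
  rewrite -christoffel_dot// mulr_sumr.
  under eq_bigr => l _ do rewrite mulrCA metricC.
  over.
rewrite exchange_big /=.
under [RHS]eq_bigr => l _ do rewrite -mulr_sumr inv_metric_mul// mulrC.
under [RHS]eq_bigr => l _ do rewrite eq_sym.
by rewrite (sum_deltar (fun l => christoffel G u i j 0 l)).
Qed.

(** * Immersions into the sphere *)
Hypothesis fS : forall u, U u -> dot (f u) (f u) = 1.

Lemma dot_f_d i u : U u -> dot (f u) ('d_ i f u) = 0.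
Proof.
move=> Uu.
have : 'd_ i (fun w => dot (f w) (f w)) u = 0.
  rewrite (derive_eq_on oU (g := cst (1 : R))) ?derive_cst ?inE//.
  by move=> w; rewrite inE => /fS.
have dfu := map_differentiable Uu; rewrite (derive_dot _ dfu dfu) dotC -mulr2n => /eqP.
by rewrite mulrn_eq0 => /eqP.
Qed.

Lemma dot_f_dd i j u : U u -> dot (f u) ('d_ i ('d_ j f) u) = - G u i j.
Proof.
move=> Uu.
have : 'd_ i (fun w => dot (f w) ('d_ j f w)) u = 0.
  rewrite (derive_eq_on oU (g := cst (0 : R))) ?derive_cst ?inE//.
  by move=> w; rewrite inE => /(dot_f_d j).
have ddf := smooth_on_differentiable (smooth_derive j) Uu.
rewrite (derive_dot _ (map_differentiable Uu) ddf).
by rewrite -metricE addrC => /eqP; rewrite addr_eq0 => /eqP.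
Qed.

Lemma normal_part_f u : U u -> normal_part f u (f u) = f u.
Proof. by move=> Uu; apply: normal_part_id => l; exact: dot_f_d. Qed.

Lemma dot_f_normal_part w u : U u -> dot (f u) (normal_part f u w) = dot (f u) w.
Proof. by move=> Uu; apply: dot_normal_partr => // l; exact: dot_f_d. Qed.

Lemma tangentE u w : normal_part f u w = 0 ->
  w = \sum_i (\sum_j gi u i j * dot w ('d_ j f u)) *: 'd_ i f u.
Proof.
move=> /eqP; rewrite /normal_part subr_eq0 => /eqP {1}->.
by apply: eq_bigr => i _; rewrite scaler_suml.
Qed.

Opaque normal_part.

(** The second fundamental forms in the sphere and in the Euclidean space differ
    by the one of the sphere, $-g f$. *)
Lemma second_formE i j u : U u -> second_form f (e i) (e j) u =
  normal_part f u ('d_ i ('d_ j f) u) + G u i j *: f u.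
Proof.
move=> Uu; rewrite /second_form /pullback_conn /tproj.
rewrite normal_partD normal_partN normal_partZ normal_part_f//.
by rewrite (dotC _ (f u)) dot_f_dd// scaleNr opprK.
Qed.

Lemma second_formC i j u : U u ->
  second_form f (e i) (e j) u = second_form f (e j) (e i) u.
Proof.
move=> Uu; have E1 := second_formE i j Uu; have E2 := second_formE j i Uu.
have E3 := derive2C i j Uu; have E4 := metricC u i j.
apply: (etrans E1); apply: (etrans _ (esym E2)).
exact: (congr2 (fun a b => normal_part f u a + b *: f u) E3 E4).
Qed.

Lemma dot_second_form_d i j l u : U u ->
  dot (second_form f (e i) (e j) u) ('d_ l f u) = 0.
Proof.
move=> Uu; rewrite second_formE// dotDl dotZl dot_f_d// mulr0 addr0.
exact: dot_normal_part.
Qed.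

Lemma dot_second_form_f i j u : U u ->
  dot (second_form f (e i) (e j) u) (f u) = 0.
Proof.
move=> Uu; rewrite second_formE// dotDl dotZl fS// mulr1.
by rewrite dotC dot_f_normal_part// dot_f_dd// addNr.
Qed.

(** Gauss formula: the tangential part of $\partial_i\partial_j f$ is removed by
    the Christoffel term, so that the tension field is $mH$. *)
Lemma nabla_dE i j u : U u ->
  nabla_d G f (e i) (e j) u = second_form f (e i) (e j) u.
Proof.
move=> Uu; rewrite /nabla_d levi_civita_basis derive_christoffel//.
rewrite second_formE// /pullback_conn /tproj (dotC _ (f u)) dot_f_dd//.
by rewrite scaleNr opprK opprB addrC addrA subrK.
Qed.

Lemma tensionE u : (0 < m)%N -> U u -> tension G f u = m%:R *: mean_curv f u.
Proof.
move=> m0 Uu; rewrite /mean_curv scalerA divff ?pnatr_eq0 -?lt0n// scale1r.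
by apply: eq_bigr => i _; apply: eq_bigr => j _; rewrite nabla_dE.
Qed.

Local Notation H := (mean_curv f).

Lemma smooth_second_form i j : smooth_on U (second_form f (e i) (e j)).
Proof.
have sG := (smooth_on_mx oU _).1 smooth_metric i j.
have := smooth_onD oU (smooth_normal_part (smooth_derive2 i j))
  (smooth_on_scale oU sG sf).
apply: smooth_on_eq => //.
by move=> u; rewrite inE => Uu; rewrite second_formE.
Qed.

Lemma smooth_mean_curv : smooth_on U H.
Proof.
apply: smooth_on_scale => //; first exact: smooth_on_cst.
do 2 apply: smooth_on_sum => // ?.
by apply: smooth_on_scale => //; [exact: smooth_inv_metric|exact: smooth_second_form].
Qed.

Lemma dot_mean_curv_d l u : U u -> dot (H u) ('d_ l f u) = 0.
Proof.
move=> Uu; rewrite dotZl dot_suml big1 ?mulr0// => i _.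
by rewrite dot_suml big1// => j _; rewrite dotZl dot_second_form_d ?mulr0.
Qed.

Lemma dot_mean_curv_f u : U u -> dot (H u) (f u) = 0.
Proof.
move=> Uu; rewrite dotZl dot_suml big1 ?mulr0// => i _.
by rewrite dot_suml big1// => j _; rewrite dotZl dot_second_form_f ?mulr0.
Qed.

Definition shape u : 'M[R]_m := weingarten f H u.
Local Notation A := shape.

(** The symmetric bilinear form $\langle B(\cdot,\cdot), H\rangle$, from which
    $A_H$ is obtained by raising an index. *)
Definition shape_form u : 'M[R]_m :=
  \matrix_(i, j) dot (second_form f (e i) (e j) u) (H u).

Lemma shapeE u : A u = shape_form u *m gi u.
Proof. by []. Qed.

Lemma shape_formE i j u : U u ->
  shape_form u i j = dot (H u) ('d_ i ('d_ j f) u).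
Proof.
move=> Uu; rewrite mxE second_formE// dotDl dotZl (dotC (f u)).
rewrite dot_mean_curv_f// mulr0 addr0 dotC dot_normal_partr// => l.
exact: dot_mean_curv_d.
Qed.

Lemma tr_shape_form u : U u -> (shape_form u)^T = shape_form u.
Proof. by move=> Uu; apply/matrixP => i j; rewrite !mxE second_formC. Qed.

Lemma shape_formC i j u : U u -> shape_form u i j = shape_form u j i.
Proof. by move=> Uu; rewrite -{1}tr_shape_form// mxE. Qed.

Lemma shape_metric u : U u -> A u *m G u = shape_form u.
Proof. by move=> Uu; rewrite /A /weingarten mulmxKV// metric_unit. Qed.

Lemma smooth_shape i j : smooth_on U (fun u => A u i j).
Proof.
apply: (smooth_on_eq oU (f := fun u =>
    \sum_k dot (second_form f (e i) (e k) u) (H u) * gi u k j)).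
  by move=> u _; rewrite /= !mxE; apply: eq_bigr => k _; rewrite mxE.
apply: smooth_on_sum => // k; apply: smooth_onM => //; last exact: smooth_inv_metric.
by apply: smooth_on_dot => //; [exact: smooth_second_form|exact: smooth_mean_curv].
Qed.

(** The trace of the second fundamental form in the Euclidean space, where the
    sphere contributes $-m f$. *)
Lemma mean_curv_sum u : (0 < m)%N -> U u ->
  \sum_i \sum_j gi u i j *: normal_part f u ('d_ i ('d_ j f) u)
  = m%:R *: (H u - f u).
Proof.
move=> m0 Uu; have m1 : m%:R != 0 :> R by rewrite pnatr_eq0 -lt0n.
rewrite scalerBr /mean_curv scalerA divff// scale1r.
apply/eqP; rewrite eq_sym subr_eq; apply/eqP.
rewrite /metric_trace.
under eq_bigr => i _.
  under eq_bigr => j _ do rewrite second_formE// scalerDr.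
  rewrite big_split.
  over.
rewrite big_split; congr (_ + _).
under eq_bigr => i _.
  under eq_bigr => j _ do rewrite scalerA metricC.
  rewrite -scaler_suml inv_metric_mul// eqxx scale1r.
  over.
by rewrite sumr_const card_ord scaler_nat.
Qed.

Lemma trace_shape u : (0 < m)%N -> U u -> \tr (A u) = m%:R * dot (H u) (H u).
Proof.
move=> m0 Uu; rewrite {2}/mean_curv dotZr mulrA divff ?pnatr_eq0 -?lt0n// mul1r.
rewrite /A /weingarten mxtrace_mulC /metric_trace dot_sumr.
apply: eq_bigr => i _; rewrite mxE dot_sumr; apply: eq_bigr => j _.
by rewrite !mxE [RHS]dotZr [in RHS]dotC second_formC.
Qed.

Opaque mean_curv second_form shape.

(** * Parallel mean curvature *)
Hypothesis pmc : forall u, U u -> forall X, normal_conn f X H u = 0.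

(** As $H$ is orthogonal to $f$ and to $M$, its derivative has no component along
    $f$ and its tangential components are $-\langle H, B\rangle$; the remaining
    normal component is $\nabla^\perp H = 0$. *)
Lemma derive_mean_curv k u : U u ->
  'd_ k H u = - \sum_l A u k l *: 'd_ l f u :> F.
Proof.
move=> Uu.
have dH : differentiable H u := smooth_on_differentiable smooth_mean_curv Uu.
have ddf j := smooth_on_differentiable (smooth_derive j) Uu.
have Hf : dot ('d_ k H u) (f u) = 0.
  have : 'd_ k (fun w => dot (H w) (f w)) u = 0.
    rewrite (derive_eq_on oU (g := cst (0 : R))) ?derive_cst ?inE//.
    by move=> w; rewrite inE => /dot_mean_curv_f.
  by rewrite derive_dot// ?dot_mean_curv_d ?addr0//; exact: map_differentiable.
have Hj j : dot ('d_ k H u) ('d_ j f u) = - shape_form u k j.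
  have : 'd_ k (fun w => dot (H w) ('d_ j f w)) u = 0.
    rewrite (derive_eq_on oU (g := cst (0 : R))) ?derive_cst ?inE//.
    by move=> w; rewrite inE => /(dot_mean_curv_d j).
  rewrite derive_dot// => /eqP; rewrite addr_eq0 => /eqP ->.
  by rewrite shape_formE.
have := pmc Uu (e k); rewrite /normal_conn /pullback_conn tprojE//.
move/tangentE => ->; rewrite -sumrN; apply: eq_bigr => i _; rewrite -scaleNr.
congr (_ *: _); rewrite shapeE mxE -sumrN; apply: eq_bigr => j _.
by rewrite Hj mulrN inv_metricC mulrC /shape_form !mxE.
Qed.

(** This is $II(e_p, A e_k)$. *)
Definition twisted p k u : F :=
  \sum_l A u k l *: normal_part f u ('d_ p ('d_ l f) u).

Lemma derive2_mean_curv p k u : U u ->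
  'd_ p ('d_ k H) u = - \sum_l
     (('d_ p (fun w => A w k l) u : R) *: 'd_ l f u
      + A u k l *: 'd_ p ('d_ l f) u) :> F.
Proof.
move=> Uu.
have -> : 'd_ p ('d_ k H) u = 'd_ p (fun w => - \sum_l A w k l *: 'd_ l f w) u.
  apply: (derive_eq_on oU); rewrite ?inE// => w.
  by rewrite inE => /(derive_mean_curv k).
have dA l := smooth_on_differentiable (smooth_shape k l) Uu.
have ddf j := smooth_on_differentiable (smooth_derive j) Uu.
have ds l := differentiable_scale (dA l) (ddf l).
have E : 'd_ p (fun w => \sum_l A w k l *: 'd_ l f w) u =
    \sum_l 'd_ p (fun w => A w k l *: 'd_ l f w) u by exact: derive_sumE.
rewrite deriveN; last first.
  apply: diff_derivable.
  rewrite (_ : (fun w => _) = \sum_l (fun w => A w k l *: 'd_ l f w)).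
    by apply: differentiable_sum.
  by apply/funext => w; rewrite fct_sumE.
rewrite E; congr (- _); apply: eq_bigr => l _.
exact: derive_scale.
Qed.

Lemma normal_part_derive2_mean_curv p k u : U u ->
  normal_part f u ('d_ p ('d_ k H) u) = - twisted p k u.
Proof.
move=> Uu; have E := derive2_mean_curv p k Uu; rewrite E normal_partN normal_part_sum.
congr (- _); apply: eq_bigr => l _.
rewrite normal_partD (normal_partZ u _ ('d_ l f u)) normal_part_d// scaler0.
rewrite add0r; exact: (normal_partZ _ _ _).
Qed.

(** Ricci equation: the second derivatives of $H$ are symmetric. *)
Lemma twistedC p k u : U u -> twisted p k u = twisted k p u.
Proof.
move=> Uu; apply: oppr_inj.
apply: (etrans (esym (normal_part_derive2_mean_curv p k Uu))).
apply: (etrans _ (normal_part_derive2_mean_curv k p Uu)).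
apply: (congr1 (normal_part f u)); exact: (derive_comm oU _ _ smooth_mean_curv Uu).
Qed.

(** * Parallel shape operator *)
Hypothesis parA : forall u, U u -> forall X Y, nabla_endo f A X Y u = 0.

(** The condition $\nabla A = 0$ without Christoffel symbols.  Since
    $\partial_k H = -df(A e_k)$ and $\nabla$ is the tangential derivative, it reads
    $(\partial_p\partial_k H)^\top = -A (\partial_p\partial_k f)^\top$; pairing
    with $\partial_r f$ moves the self-adjoint $A$ to the other side. *)
Lemma parallel_shape p k r u : U u ->
  dot ('d_ p ('d_ k H) u) ('d_ r f u) = dot ('d_ p ('d_ k f) u) ('d_ r H u).
Proof.
move=> Uu.
have E l : 'd_ p (fun w => A w k l) u + \sum_j A u k j * christoffel G u p j 0 l
    = \sum_j christoffel G u p k 0 j * A u j l.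
  have /eqP := parA Uu (e p) (e k).
  rewrite /nabla_endo levi_civita_basis subr_eq0 => /eqP /rowP /(_ l).
  rewrite [RHS]mxE => <-; rewrite levi_civita_basisl mxE; congr (_ + _).
    have EA b : (fun y => (e k *m A y) 0 b) = (fun y => A y k b).
      by apply/funext => y; exact: basis_vec_mul.
    rewrite derive_mxE; last first.
      apply: differentiable_mx => a b; rewrite (ord1 a) EA.
      exact: smooth_on_differentiable (smooth_shape k b) Uu.
    rewrite EA; reflexivity.
  rewrite summxE; apply: eq_bigr => j _.
  by rewrite basis_vec_mul [in RHS]mxE.
have E1 := derive_mean_curv r Uu; have E2 := derive2_mean_curv p k Uu.
rewrite E1 E2 dotNl dotNr; congr (- _).
rewrite dot_suml dot_sumr.
transitivity (\sum_l ('d_ p (fun w => A w k l) u +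
    \sum_j A u k j * christoffel G u p j 0 l) * G u l r).
  under eq_bigr => l _ do rewrite dotDl !dotZl.
  under [RHS]eq_bigr => l _ do rewrite mulrDl metricE.
  rewrite !big_split; apply: (congr1 (+%R _)).
  under [RHS]eq_bigr => l _.
    rewrite mulr_suml; under eq_bigr => j _ do rewrite -metricE -mulrA.
    over.
  rewrite exchange_big; apply: eq_bigr => j _.
  by rewrite -mulr_sumr christoffel_dot.
under eq_bigr => l _ do rewrite E mulr_suml.
rewrite exchange_big /=.
have S i j : \sum_l A u i l * G u l j = shape_form u i j.
  by rewrite -shape_metric// mxE.
under eq_bigr => j _.
  under eq_bigr => l _ do rewrite -mulrA.
  rewrite -mulr_sumr S (shape_formC j r Uu) -S mulr_sumr.
  over.
rewrite exchange_big; apply: eq_bigr => l _ /=.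
rewrite dotZr -christoffel_dot// mulr_sumr; apply: eq_bigr => j _.
by rewrite (metricC _ l j) mulrCA.
Qed.

Lemma inv_metric_shape_sym u : U u -> (gi u *m A u)^T = gi u *m A u.
Proof.
move=> Uu; by rewrite shapeE !trmx_mul !tr_inv_metric (tr_shape_form Uu) mulmxA.
Qed.

Lemma derive_parallel_shape q p k r u : U u ->
  dot ('d_ q ('d_ p ('d_ k H)) u) ('d_ r f u)
    + dot ('d_ p ('d_ k H) u) ('d_ q ('d_ r f) u)
  = dot ('d_ q ('d_ p ('d_ k f)) u) ('d_ r H u)
    + dot ('d_ p ('d_ k f) u) ('d_ q ('d_ r H) u).
Proof.
move=> Uu.
have sH := smooth_mean_curv.
have sdH i : smooth_on U ('d_ i H) by exact: smooth_on_derive.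
have D g : smooth_on U g -> differentiable g u.
  by move=> sg; exact: smooth_on_differentiable sg Uu.
have E1 : 'd_ q (fun w => dot ('d_ p ('d_ k H) w) ('d_ r f w)) u =
    'd_ q (fun w => dot ('d_ p ('d_ k f) w) ('d_ r H w)) u.
  apply: (derive_eq_on oU); rewrite ?inE// => w.
  by rewrite inE; exact: parallel_shape.
have d1 := D _ _ (smooth_on_derive (e p) (sdH k)).
have d2 := D _ _ (smooth_derive r).
have d3 := D _ _ (smooth_derive2 p k).
have d4 := D _ _ (sdH r).
apply: (etrans (esym (derive_dot (e q) d1 d2))).
by apply: (etrans E1); exact: (derive_dot (e q) d3 d4).
Qed.

(** The tangential parts of $\partial_p\partial_k H$ and $\partial_q\partial_r H$
    are the images of those of $f$ by the self-adjoint $-A$, so they contribute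
    equally to the two products. *)
Lemma tangential_cancel p k q r u : U u ->
  dot ('d_ p ('d_ k H) u) ('d_ q ('d_ r f) u)
    - dot ('d_ p ('d_ k f) u) ('d_ q ('d_ r H) u) =
  dot (normal_part f u ('d_ p ('d_ k f) u)) (twisted q r u)
    - dot (twisted p k u) (normal_part f u ('d_ q ('d_ r f) u)).
Proof.
move=> Uu.
have N1 := normal_part_derive2_mean_curv p k Uu.
have N2 := normal_part_derive2_mean_curv q r Uu.
have E1 := normal_part_dot_eq Uu N1 (erefl (normal_part f u ('d_ q ('d_ r f) u))).
have E2 := normal_part_dot_eq Uu (erefl (normal_part f u ('d_ p ('d_ k f) u))) N2.
apply: (@cancel_common R _ _ _ _ _ _ _ _ E1 E2 _ (dotNl _ _) (dotNr _ _)).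
move=> {E1 E2 N1 N2}.
pose x a b i := dot ('d_ a ('d_ b f) u) ('d_ i f u).
have dH i a b : dot ('d_ a ('d_ b f) u) ('d_ i H u) = - \sum_l A u i l * x a b l.
  have Ei := derive_mean_curv i Uu; rewrite Ei dotNr dot_sumr.
  by under eq_bigr => l _ do rewrite dotZr.
have Es := selfadjoint_sum (x p k) (x q r) (inv_metric_shape_sym Uu) (tr_inv_metric u).
apply: etrans (etrans Es _).
  apply: eq_bigr => i _; apply: eq_bigr => j _.
  exact: (congr1 (fun a => gi u i j * a * x q r j)
      (etrans (parallel_shape p k i Uu) (dH i p k))).
apply: eq_bigr => i _; apply: eq_bigr => j _; symmetry.
exact: (congr1 (fun a => gi u i j * x p k i * a)
    (etrans (parallel_shape q r j Uu) (dH j q r))).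
Qed.

(** The third derivatives of $f$ and $H$ drop out of the difference of two copies
    of [derive_parallel_shape] with $p$ and $q$ exchanged.  By the Gauss equation
    the result expresses that the curvature tensor of $M$ commutes with $A$. *)
Lemma gauss_identity p q k r u : U u ->
  dot (twisted p k u) (normal_part f u ('d_ q ('d_ r f) u))
   - dot (normal_part f u ('d_ p ('d_ k f) u)) (twisted q r u) =
  dot (twisted q k u) (normal_part f u ('d_ p ('d_ r f) u))
   - dot (normal_part f u ('d_ q ('d_ k f) u)) (twisted p r u).
Proof.
move=> Uu.
apply: (opposite_differences (tangential_cancel p k q r Uu)
  (tangential_cancel q k p r Uu)).
have E1 := derive_parallel_shape q p k r Uu.
have E2 := derive_parallel_shape p q k r Uu.
have sdH i : smooth_on U ('d_ i H) by exact/smooth_on_derive/smooth_mean_curv.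
have C1 : 'd_ q ('d_ p ('d_ k H)) u = 'd_ p ('d_ q ('d_ k H)) u :> F.
  exact: (derive_comm oU _ _ (sdH k) Uu).
have C2 : 'd_ q ('d_ p ('d_ k f)) u = 'd_ p ('d_ q ('d_ k f)) u :> F.
  exact: (derive_comm oU _ _ (smooth_derive k) Uu).
apply: (@cancel_first R _ _ _ _ _ _ _ _ E1 E2).
  exact: (congr1 (fun z : F => dot z ('d_ r f u)) C1).
exact: (congr1 (fun z : F => dot z ('d_ r H u)) C2).
Qed.

(** * The biharmonic equation *)
Hypothesis m0 : (0 < m)%N.
Hypothesis bih : forall u, U u -> bitension G f u = 0.

(** Against a vector $\xi$ normal to $M$ and to $f$, the Christoffel terms of the
    Laplacian vanish because the derivatives of $H$ are tangent to $M$, and the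
    curvature term of the sphere reduces to $m\langle\tau, \xi\rangle$. *)
Lemma biharmonic_normal u xi : U u -> dot xi (f u) = 0 ->
  (forall l, dot xi ('d_ l f u) = 0) ->
  m%:R * dot (H u) xi = - \sum_p \sum_k gi u p k * dot ('d_ p ('d_ k H) u) xi.
Proof.
move=> Uu xif xid; pose V := tension G f.
have m1 : m%:R != 0 :> R by rewrite pnatr_eq0 -lt0n.
have VE w : U w -> V w = m%:R *: H w by exact: tensionE.
have DH w X : U w -> derivable H w X.
  move=> Uw; apply: diff_derivable.
  exact: smooth_on_differentiable smooth_mean_curv Uw.
have DV X w : U w -> 'D_X V w = m%:R *: 'D_X H w :> F.
  move=> Uw; apply: (@etrans _ _ ('D_X (m%:R *: H) w)).
    by apply: (derive_eq_on oU); rewrite ?inE// => y; rewrite inE; exact: VE.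
  by apply: deriveZ; exact: DH.
have dirH X w z : U w -> (forall l, dot z ('d_ l f w) = 0) ->
    dot ('D_X H w) z = 0.
  move=> Uw zd.
  have E := derive_dir X (smooth_on_differentiable smooth_mean_curv Uw).
  rewrite E dot_suml big1// => i _; rewrite dotZl.
  have Ei := derive_mean_curv i Uw.
  rewrite Ei dotNl dot_suml big1 ?oppr0 ?mulr0// => l _.
  by rewrite dotZl dotC zd mulr0.
have pbV k w : U w -> pullback_conn f (e k) V w = m%:R *: 'd_ k H w :> F.
  move=> Uw; rewrite /pullback_conn.
  apply: (etrans (congr1 (tproj (f w)) (DV (e k) w Uw))).
  by apply: tprojE; rewrite dotZl dirH ?mulr0// => l; exact: dot_f_d.
have tp z : dot (tproj (f u) z) xi = dot z xi.
  by rewrite /tproj dotBl dotZl (dotC (f u)) xif mulr0 subr0.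
have n2 p k : dot (nabla2 G f V (e p) (e k) u) xi =
    m%:R * dot ('d_ p ('d_ k H) u) xi.
  apply: (etrans (dotBl _ _ _)).
  apply: (etrans (congr2 (fun a b => a - b) (tp _) (tp _))).
  rewrite [X in _ - X](_ : _ = 0) ?subr0; last first.
    apply: (etrans (congr1 (fun z : F => dot z xi) (DV _ u Uu))).
    by rewrite dotZl dirH ?mulr0.
  rewrite -dotZl; apply: (congr1 (fun z : F => dot z xi)).
  apply: (@etrans _ _ ('d_ p (m%:R *: 'd_ k H) u)).
    by apply: (derive_eq_on oU); rewrite ?inE// => y; rewrite inE; exact: pbV.
  apply: deriveZ; apply: diff_derivable.
  exact: smooth_on_differentiable (smooth_on_derive _ smooth_mean_curv) Uu.
have cv p k : dot (sphere_curv (f u) ('d_ p f u) (V u) ('d_ k f u)) xi =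
    - G u p k * (m%:R * dot (H u) xi).
  rewrite sphere_curvE ?fS// ?(dotC _ (f u)) ?dot_f_d//; last first.
    by rewrite VE// dotZr dotC dot_mean_curv_f// mulr0.
  rewrite VE// dotBl !(dotZl (dot _ _)) !(dotZl m%:R (H u)) dot_mean_curv_d//.
  rewrite mulr0 mul0r sub0r metricE mulNr.
  reflexivity.
have := congr1 (fun z : F => dot z xi) (bih Uu).
rewrite /bitension /rough_laplacian opprK dotBl dot0l => B.
have S1 : dot (metric_trace G u (fun X Y => nabla2 G f V X Y u)) xi =
    \sum_p \sum_k gi u p k * (m%:R * dot ('d_ p ('d_ k H) u) xi).
  apply: (etrans (dot_metric_trace _ _ _)).
  apply: eq_bigr => p _; apply: eq_bigr => k _.
  exact: (congr1 ( *%R _) (n2 p k)).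
have S2 : dot (metric_trace G u
      (fun X Y => sphere_curv (f u) ('D_X f u) (V u) ('D_Y f u))) xi =
    \sum_p \sum_k gi u p k * (- G u p k * (m%:R * dot (H u) xi)).
  apply: (etrans (dot_metric_trace _ _ _)).
  apply: eq_bigr => p _; apply: eq_bigr => k _.
  exact: (congr1 ( *%R _) (cv p k)).
have B1 := equal_of_sub0 B S1 S2.
apply: (mulfI m1).
have -> : m%:R * (m%:R * dot (H u) xi) =
    - \sum_p \sum_k gi u p k * (- G u p k * (m%:R * dot (H u) xi)).
  under eq_bigr => p _.
    under eq_bigr => k _ do rewrite mulrA mulrN metricC mulNr.
    rewrite sumrN -mulr_suml inv_metric_mul// eqxx mul1r.
    over.
  by rewrite sumrN opprK sumr_const card_ord mulr_natl.
rewrite -B1 mulrN mulr_sumr; apply: (congr1 -%R); apply: eq_bigr => p _.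
by rewrite mulr_sumr; apply: eq_bigr => k _; rewrite mulrCA.
Qed.

(** The trace of [gauss_identity]: both traced tensors are combinations of $H$
    and $f$, whose products with $II$ are $\langle A\cdot,\cdot\rangle$ and
    $-g$. *)
Lemma square_shape u : U u -> A u *m A u = (dot (H u) (H u))%:M.
Proof.
move=> Uu; have m1 : m%:R != 0 :> R by rewrite pnatr_eq0 -lt0n.
pose N p k := normal_part f u ('d_ p ('d_ k f) u).
pose T p k := twisted p k u.
pose W := \sum_p \sum_k gi u p k *: T p k.
have NC p k : N p k = N k p.
  by apply: (congr1 (normal_part f u)); exact: derive2C.
have fN p k : dot (f u) (N p k) = - G u p k.
  by rewrite /N dot_f_normal_part//; exact: dot_f_dd.
have Nd p k l : dot (N p k) ('d_ l f u) = 0 by exact: dot_normal_part.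
have HN p k : dot (H u) (N p k) = shape_form u p k.
  rewrite /N dot_normal_partr//; last by move=> l; exact: dot_mean_curv_d.
  by rewrite -shape_formE.
have AG p k : \sum_l A u p l * G u l k = shape_form u p k.
  by rewrite -shape_metric// mxE.
have Td p k l : dot (T p k) ('d_ l f u) = 0.
  by rewrite /T /twisted dot_suml big1// => j _; rewrite dotZl Nd mulr0.
have Tf p k : dot (T p k) (f u) = - shape_form u p k.
  rewrite shape_formC// -AG -sumrN /T /twisted dot_suml; apply: eq_bigr => l _.
  by rewrite dotZl dotC fN metricC mulrN.
have Wf : dot W (f u) = - \tr (A u).
  rewrite shapeE mxtrace_mulC /mxtrace -sumrN dot_suml.
  apply: eq_bigr => p _; rewrite mxE -sumrN dot_suml; apply: eq_bigr => k _.
  by rewrite dotZl Tf shape_formC// mulrN.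
have WB q r : dot W (second_form f (e q) (e r) u) = m%:R * shape_form u q r.
  pose xi := second_form f (e q) (e r) u.
  have xif : dot xi (f u) = 0 by exact: dot_second_form_f.
  have xid l : dot xi ('d_ l f u) = 0 by exact: dot_second_form_d.
  have B := biharmonic_normal Uu xif xid.
  have -> : shape_form u q r = dot (H u) xi by rewrite /shape_form mxE dotC.
  rewrite B -sumrN dot_suml; apply: eq_bigr => p _.
  rewrite -sumrN dot_suml; apply: eq_bigr => k _.
  rewrite dotZl -mulrN; apply: (congr1 ( *%R _)).
  have Ep := etrans (congr1 (dot xi) (esym (normal_part_derive2_mean_curv p k Uu)))
    (dot_normal_partr _ Uu xid).
  apply: (etrans _ (congr1 -%R (etrans Ep (dotC _ _)))).
  by rewrite dotNr opprK dotC.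
have := gauss_contraction (tr_inv_metric u) (inv_metric_shape_sym Uu)
  (fun p k => erefl (T p k)) NC (fun p k => twistedC p k Uu)
  (fun p q k r => gauss_identity p q k r Uu).
move=> K.
have tr q r : \tr (A u) * G u q r = m%:R * (A u *m A u *m G u) r q.
  have := K q r; rewrite (mean_curv_sum m0 Uu) -/W -/(N q r).
  have -> : N q r = second_form f (e q) (e r) u - G u q r *: f u.
    apply: (etrans _ (congr1 (fun z : F => z - G u q r *: f u)
      (esym (second_formE q r Uu)))).
    exact: esym (addrK _ _).
  rewrite dotBr WB dotZr Wf dotZl dotBl.
  have -> : dot (f u) (T q r) = - shape_form u q r by rewrite dotC Tf.
  have -> : dot (H u) (T q r) = (A u *m A u *m G u) r q.
    rewrite -mulmxA shape_metric// mxE /T /twisted dot_sumr; apply: eq_bigr => l _.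
    by rewrite dotZr HN shape_formC.
  by move=> X; lra.
apply: (can_inj (mulmxK (metric_unit Uu))).
apply/matrixP => r q; apply: (mulfI m1); rewrite -tr trace_shape// mul_scalar_mx.
by rewrite [RHS](congr1 ( *%R _) (mxE _ _ _ _)) -mulrA metricC.
Qed.

End Patch.

(** * Independence of the chart *)

Lemma exchange_big3 (V : nmodType) (I : finType) (X : I -> I -> I -> V) :
  \sum_k \sum_i \sum_j X k i j = \sum_j \sum_i \sum_k X k i j.
Proof.
rewrite [LHS]exchange_big [RHS]exchange_big; apply: eq_bigr => i _ /=.
by rewrite exchange_big.
Qed.

Lemma exchange_big4 (V : nmodType) (I : finType) (X : I -> I -> I -> I -> V) :
  \sum_p \sum_k \sum_i \sum_j X p k i j = \sum_j \sum_i \sum_k \sum_p X p k i j.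
Proof.
transitivity (\sum_p \sum_j \sum_i \sum_k X p k i j).
  by apply: eq_bigr => p _; exact: exchange_big3.
rewrite exchange_big; apply: eq_bigr => j _ /=.
rewrite exchange_big; apply: eq_bigr => i _ /=.
by rewrite exchange_big.
Qed.

Section Reparametrization.
Context {R : realType} {m n : nat}.
Local Notation E := 'rV[R]_m.
Local Notation F := 'rV[R]_n.+1.
Local Notation e := (@basis_vec R m).
Local Notation "''d_' i g" := ('D_(e i) g) (at level 10, i, g at next level).
Local Notation "''d_' i g u" := ('D_(e i) g u)
  (at level 10, i, g, u at next level).
Variables (f1 f2 : E -> F) (U1 U2 W : set E) (phi : E -> E).
Hypotheses (oU1 : open U1) (oU2 : open U2) (oW : open W).
Hypotheses (sf1 : smooth_on U1 f1) (sf2 : smooth_on U2 f2).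
Hypothesis sphi : smooth_on W phi.
Hypothesis immersed1 : forall u, U1 u -> forall v, v != 0 -> 'D_v f1 u != 0.
Hypothesis immersed2 : forall u, U2 u -> forall v, v != 0 -> 'D_v f2 u != 0.
Hypothesis f1S : forall u, U1 u -> dot (f1 u) (f1 u) = 1.
Hypothesis f2S : forall u, U2 u -> dot (f2 u) (f2 u) = 1.
Hypothesis WU1 : forall u, W u -> U1 u.
Hypothesis phiU2 : forall u, W u -> U2 (phi u).
Hypothesis f1E : forall u, W u -> f1 u = f2 (phi u).

Definition jacobian_rows u : 'M[R]_m := \matrix_(k, i) 'd_ k phi u 0 i.
Local Notation J := jacobian_rows.

Lemma derive_reparam k u : W u ->
  'd_ k f1 u = \sum_i J u k i *: 'd_ i f2 (phi u) :> F.
Proof.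
move=> Wu; have dphi := smooth_on_differentiable sphi Wu.
have df2 := smooth_on_differentiable sf2 (phiU2 Wu).
apply: (@etrans _ _ ('d_ k (f2 \o phi) u)).
  by apply: (derive_eq_on oW); rewrite ?inE// => w; rewrite inE; exact: f1E.
apply: (etrans (derive_comp _ dphi df2)); apply: (etrans (derive_dir _ df2)).
by apply: eq_bigr => i _; rewrite /J mxE.
Qed.

(** The terms with derivatives of the Jacobian are tangent to the submanifold,
    which is why the second fundamental form transforms as a tensor. *)
Lemma derive2_reparam p k u : W u ->
  'd_ p ('d_ k f1) u =
  \sum_i (('d_ p (fun w => J w k i) u : R) *: 'd_ i f2 (phi u) +
     J u k i *: \sum_j J u p j *: 'd_ j ('d_ i f2) (phi u)) :> F.
Proof.
move=> Wu; have dphi := smooth_on_differentiable sphi Wu.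
have dJ i : differentiable (fun w => J w k i) u.
  rewrite (_ : (fun w => _) = fun w => 'd_ k phi w 0 i); last first.
    by apply/funext => w; rewrite mxE.
  apply: differentiable_entry.
  exact: smooth_on_differentiable (smooth_on_derive _ sphi) Wu.
have df2 i : differentiable ('d_ i f2) (phi u).
  exact: smooth_on_differentiable (smooth_derive sf2 i) (phiU2 Wu).
have dc i : differentiable ('d_ i f2 \o phi) u by exact: differentiable_comp.
apply: (@etrans _ _ ('d_ p (fun w => \sum_i J w k i *: ('d_ i f2 \o phi) w) u)).
  by apply: (derive_eq_on oW); rewrite ?inE// => w; rewrite inE; exact: derive_reparam.
apply: etrans (derive_sumE _ (fun i => differentiable_scale (dJ i) (dc i))) _.
apply: eq_bigr => i _; apply: (etrans (derive_scale _ (dJ i) (dc i))).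
apply: (congr1 (fun z : F => 'd_ p (fun w => J w k i) u *: 'd_ i f2 (phi u)
  + J u k i *: z)).
apply: (etrans (derive_comp _ dphi (df2 i))); apply: (etrans (derive_dir _ (df2 i))).
by apply: eq_bigr => j _; rewrite /J mxE.
Qed.

Lemma metric_reparam u : W u ->
  induced_metric f1 u = J u *m induced_metric f2 (phi u) *m (J u)^T.
Proof.
move=> Wu; apply/matrixP => k l.
have Ek := derive_reparam k Wu; have El := derive_reparam l Wu.
rewrite metricE Ek El dot_sumr mxE; apply: eq_bigr => j _.
have T1 : (J u)^T j l = J u l j by exact: mxE.
have T2 : (J u *m induced_metric f2 (phi u)) k j =
    \sum_i J u k i * induced_metric f2 (phi u) i j by exact: mxE.
rewrite T1 T2 dotZr [RHS]mulrC; apply: (congr1 ( *%R _)); rewrite dot_suml.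
by apply: eq_bigr => i _; rewrite dotZl metricE.
Qed.

Lemma jacobian_unit u : W u -> J u \in unitmx.
Proof.
move=> Wu; have := metric_unit sf1 immersed1 (WU1 Wu).
by rewrite metric_reparam// !unitmx_mul => /andP[/andP[]].
Qed.

Lemma inv_metric_reparam u : W u ->
  (J u)^T *m invmx (induced_metric f1 u) *m J u
  = invmx (induced_metric f2 (phi u)).
Proof.
move=> Wu; have uJ := jacobian_unit Wu.
have uJT : (J u)^T \in unitmx by rewrite unitmx_tr.
have uG1 := metric_unit sf1 immersed1 (WU1 Wu).
have uG2 := metric_unit sf2 immersed2 (phiU2 Wu).
apply: (can_inj (mulKmx uG2)); rewrite (mulmxV uG2).
apply: (can_inj (mulKmx uJ)); rewrite mulmx1 !mulmxA -metric_reparam//.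
by rewrite (mulmxV uG1) mul1mx.
Qed.

Lemma derive_reparam_inv i u : W u ->
  'd_ i f2 (phi u) = \sum_k invmx (J u) i k *: 'd_ k f1 u :> F.
Proof.
move=> Wu.
under eq_bigr => k _.
  rewrite (derive_reparam k Wu) scaler_sumr.
  over.
rewrite exchange_big /=.
under eq_bigr => j _.
  under eq_bigr => k _ do rewrite scalerA.
  rewrite -scaler_suml (_ : \sum_k _ = (j == i)%:R); last first.
    have /matrixP/(_ i j) := mulVmx (jacobian_unit Wu).
    by rewrite !mxE eq_sym.
  over.
by rewrite sum_delta.
Qed.

(** Both parametrizations have the same tangent space, since the Jacobian is
    invertible. *)
Lemma normal_part_reparam u w : W u ->
  normal_part f1 u w = normal_part f2 (phi u) w.
Proof.
move=> Wu; have Uu := WU1 Wu; have Up := phiU2 Wu.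
set z := normal_part f2 (phi u) w.
have zd l : dot z ('d_ l f1 u) = 0.
  have El := derive_reparam l Wu; rewrite El dot_sumr big1// => i _.
  by rewrite dotZr (dot_normal_part sf2 immersed2) ?mulr0.
have N2 : normal_part f2 (phi u) (w - z) = 0.
  rewrite normal_partD normal_partN (normal_part_id (w := z)) ?subrr// => l.
  exact: (dot_normal_part sf2 immersed2).
have N0 i : normal_part f1 u ('d_ i f2 (phi u)) = 0.
  apply: (etrans (congr1 (normal_part f1 u) (derive_reparam_inv i Wu))).
  apply: (etrans (normal_part_sum _ _ _)); apply: big1 => k _.
  by rewrite normal_partZ (normal_part_d sf1 immersed1)// scaler0.
have T0 : normal_part f1 u (w - z) = 0.
  apply: (etrans (congr1 (normal_part f1 u) (tangentE N2))).
  apply: (etrans (normal_part_sum _ _ _)); apply: big1 => i _.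
  by apply: (etrans (normal_partZ _ _ _ _)); rewrite N0 scaler0.
by rewrite -[w in LHS](subrK z) normal_partD T0 add0r (normal_part_id zd).
Qed.

Lemma mean_curv_reparam u : (0 < m)%N -> W u ->
  mean_curv f1 u = mean_curv f2 (phi u).
Proof.
move=> m0 Wu; have Uu := WU1 Wu; have Up := phiU2 Wu.
have m1 : m%:R != 0 :> R by rewrite pnatr_eq0 -lt0n.
apply: (@addIr _ (- f1 u)); rewrite {2}(f1E Wu).
apply: (scalerI m1).
rewrite -(mean_curv_sum oU1 sf1 immersed1 f1S m0 Uu).
rewrite -(mean_curv_sum oU2 sf2 immersed2 f2S m0 Up).
pose N i j := normal_part f2 (phi u) ('d_ i ('d_ j f2) (phi u)).
pose g p k := invmx (induced_metric f1 u) p k.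
transitivity (\sum_p \sum_k g p k *: \sum_i J u k i *: \sum_j J u p j *: N j i).
  apply: eq_bigr => p _; apply: eq_bigr => k _; apply: (congr1 ( *:%R _)).
  rewrite normal_part_reparam//.
  have E2 := derive2_reparam p k Wu; rewrite E2 normal_part_sum.
  apply: eq_bigr => i _; rewrite normal_partD normal_partZ.
  rewrite (normal_part_d sf2 immersed2)// scaler0 add0r normal_partZ.
  apply: (congr1 ( *:%R _)); rewrite normal_part_sum.
  by apply: eq_bigr => j _; rewrite normal_partZ.
transitivity (\sum_j \sum_i ((J u)^T *m invmx (induced_metric f1 u) *m J u) j i
  *: N j i); last by rewrite inv_metric_reparam.
transitivity (\sum_p \sum_k \sum_i \sum_j (g p k * J u k i * J u p j) *: N j i).
  apply: eq_bigr => p _; apply: eq_bigr => k _.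
  rewrite scaler_sumr; apply: eq_bigr => i _.
  rewrite scalerA scaler_sumr; apply: eq_bigr => j _.
  by rewrite scalerA.
apply: (etrans (exchange_big4 (fun p k i j => (g p k * J u k i * J u p j) *: N j i))).
apply: eq_bigr => j _; apply: eq_bigr => i _.
rewrite mxE scaler_suml; apply: eq_bigr => k _.
rewrite -scaler_suml; apply: (congr1 ( *:%R^~ _)).
have T : ((J u)^T *m invmx (induced_metric f1 u)) j k = \sum_p J u p j * g p k.
  by rewrite mxE; apply: eq_bigr => p _; rewrite [X in X * _]mxE.
rewrite T mulr_suml; apply: eq_bigr => p _; ring.
Qed.

End Reparametrization.

(** * Principal curvatures *)

(** Two integers at distance less than 1 are equal. *)
Lemma half_integer_rigid (R : realFieldType) (c h k : R) (a b : nat) : 0 < c ->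
  a%:R = c * (1 + h) / 2 -> b%:R = c * (1 + k) / 2 -> `|h - k| < c^-1 -> k = h.
Proof.
move=> c0 ah bk; rewrite -(ltr_pM2l c0) divff ?gt_eqF// => hk.
have ab : a = b.
  have : `|a%:R - b%:R| < 1 :> R.
    rewrite (_ : a%:R - b%:R = c * (h - k) / 2); last by rewrite ah bk; field.
    rewrite !normrM normfV (gtr0_norm c0) (ger0_norm (ler0n _ 2)).
    by rewrite ltr_pdivrMr// mul1r (lt_trans hk)// ltr1n.
  rewrite ltr_norml => /andP[lo hi].
  have : b%:R < a.+1%:R :> R by rewrite -natr1; lra.
  have : a%:R < b.+1%:R :> R by rewrite -natr1; lra.
  by rewrite !ltr_nat; lia.
move: ah; rewrite ab bk => E.
have /eqP : c * (k - h) = 0 by lra.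
by rewrite mulf_eq0 gt_eqF//= subr_eq0 => /eqP.
Qed.

Section PrincipalCurvatures.
Context {R : realType} {m n : nat}.
Variable M : sphere_submanifold R m n.
Hypothesis hm : (2 < m)%N.
Hypothesis hbih : biharmonic M.
Hypothesis hH : parallel_mean_curv M.
Hypothesis hA : parallel_A_H M.
Hypothesis hnorm : forall (i : chart M) (u : 'rV[R]_m), img i u ->
  0 < mean_curvature i u < (m%:R - 2%:R) / m%:R.

Let m0 : (0 < m)%N. Proof. exact: ltn_trans hm. Qed.

Let mR0 : 0 < m%:R :> R. Proof. by rewrite ltr0n. Qed.

Lemma patch_sphere (i : chart M) u : img i u -> dot (Defs.patch i u) (Defs.patch i u) = 1.
Proof. by move=> _; exact: incl_sphere. Qed.

Lemma mean_curvature_sqr (i : chart M) u :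
  mean_curvature i u ^+ 2 = dot (mean_curv (Defs.patch i) u) (mean_curv (Defs.patch i) u).
Proof.
rewrite sqr_sqrtr//; apply: sumr_ge0 => k _.
by rewrite -expr2 sqr_ge0.
Qed.

Lemma mean_curvature_bounds (i : chart M) u : img i u ->
  0 < mean_curvature i u < 1.
Proof.
move=> /hnorm/andP[-> h1] /=; apply: (lt_trans h1).
by rewrite ltr_pdivrMr// mul1r ltrBlDr ltrDl ltr0n.
Qed.

Lemma A_H_square (i : chart M) u : img i u ->
  A_H i u *m A_H i u = (mean_curvature i u ^+ 2)%:M.
Proof.
move=> Uu; rewrite mean_curvature_sqr.
exact: (square_shape (@img_open _ _ M i) (@incl_smooth _ _ _ M i)
  (@incl_immersion _ _ _ M i) (@patch_sphere i) (@hH i) (@hA i) m0 (@hbih i) Uu).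
Qed.

Lemma A_H_trace (i : chart M) u : img i u ->
  \tr (A_H i u) = m%:R * mean_curvature i u ^+ 2.
Proof.
move=> Uu; rewrite mean_curvature_sqr.
exact: (trace_shape (@img_open _ _ M i) (@incl_smooth _ _ _ M i) (@patch_sphere i) m0 Uu).
Qed.

Lemma rank_eigenspace_pos (i : chart M) u : img i u ->
  (\rank (eigenspace (A_H i u) (mean_curvature i u)))%:R
  = m%:R * (1 + mean_curvature i u) / 2 :> R.
Proof.
move=> Uu; have /andP[h0 _] := mean_curvature_bounds Uu.
rewrite (rank_eigenspace_square_scalar (lt0r_neq0 h0) (A_H_square Uu)).
rewrite A_H_trace//; set h := mean_curvature i u in h0 *.
by field; rewrite gt_eqF.
Qed.

Lemma rank_eigenspace_neg (i : chart M) u : img i u ->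
  (\rank (eigenspace (A_H i u) (- mean_curvature i u)))%:R
  = m%:R * (1 - mean_curvature i u) / 2 :> R.
Proof.
move=> Uu; have /andP[h0 _] := mean_curvature_bounds Uu.
have AA := A_H_square Uu; rewrite -sqrrN in AA.
rewrite (rank_eigenspace_square_scalar _ AA) ?oppr_eq0 ?gt_eqF//.
rewrite A_H_trace//; set h := mean_curvature i u in h0 *.
by field; rewrite gt_eqF.
Qed.

(** $|H|$ is continuous, and $m(1+|H|)/2$ is an integer, being a multiplicity. *)
Lemma mean_curvature_locally_constant (i : chart M) u : img i u ->
  \forall w \near u, mean_curvature i w = mean_curvature i u.
Proof.
move=> Uu.
have nU : \forall w \near u, img i w.
  by apply: open_nbhs_nbhs; split => //; exact: (@img_open _ _ M _).
have sH := smooth_mean_curv (@img_open _ _ M i) (@incl_smooth _ _ _ M i)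
  (@incl_immersion _ _ _ M i) (@patch_sphere i).
have cH : {for u, continuous (mean_curvature i)}.
  pose q w := dot (mean_curv (Defs.patch i) w) (mean_curv (Defs.patch i) w).
  rewrite -[mean_curvature i]/(Num.sqrt \o q).
  apply: continuous_comp; last exact: sqrt_continuous.
  have dH : differentiable (mean_curv (Defs.patch i)) u.
    exact: smooth_on_differentiable sH Uu.
  exact: differentiable_continuous (differentiable_dot dH dH).
have close : \forall w \near u,
    `|mean_curvature i u - mean_curvature i w| < m%:R^-1.
  move/cvgrPdist_lt : cH => /(_ m%:R^-1); apply.
  by rewrite invr_gt0.
near=> w.
have Uw : img i w by near: w.
have cw : `|mean_curvature i u - mean_curvature i w| < m%:R^-1 by near: w.
exact: (half_integer_rigid mR0 (rank_eigenspace_pos Uu) (rank_eigenspace_pos Uw) cw).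
Unshelve. all: by end_near. Qed.

Lemma mean_curvature_chart (i j : chart M) p : dom i p -> dom j p ->
  mean_curvature i (Defs.coord i p) = mean_curvature j (Defs.coord j p).
Proof.
move=> ip jp.
pose W := img i `&` param i @^-1` dom j.
have oW : open W.
  have := @param_continuous _ _ M i.
  rewrite continuous_open_subspace; last exact: img_open.
  by move/(continuous_inP _ (@img_open _ _ M i)); apply; exact: dom_open.
have Wp : W (Defs.coord i p) by split; [exact: coord_img|rewrite /preimage/= coordK].
have E := @mean_curv_reparam R m n (Defs.patch i) (Defs.patch j) (img i) (img j) W
  (Defs.coord j \o param i) (@img_open _ _ M i) (@img_open _ _ M j) oW
  (@incl_smooth _ _ _ M i) (@incl_smooth _ _ _ M j)
  (@transition_smooth _ _ M i j) (@incl_immersion _ _ _ M i) (@incl_immersion _ _ _ M j)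
  (@patch_sphere i) (@patch_sphere j).
have E1 : mean_curv (Defs.patch i) (Defs.coord i p) =
    mean_curv (Defs.patch j) ((Defs.coord j \o param i) (Defs.coord i p)).
  apply: E => //.
  - by move=> u [].
  - by move=> u [_ ju]; exact: coord_img.
  - by move=> u [_ ju]; rewrite /Defs.patch/= coordK.
by rewrite /mean_curvature E1 /= coordK.
Qed.

(** By connectedness: the set where $|H|$ takes a given value is open, and so is
    its complement. *)
Lemma mean_curvature_constant (i j : chart M) u v : img i u -> img j v ->
  mean_curvature i u = mean_curvature j v.
Proof.
move=> Uu Uv.
have loc (k : chart M) (p : M) : dom k p -> \forall q \near p,
    dom k q /\ mean_curvature k (Defs.coord k q) = mean_curvature k (Defs.coord k p).
  move=> kp; have nd : \forall q \near p, dom k q.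
    by apply: open_nbhs_nbhs; split => //; exact: dom_open.
  have cc : Defs.coord k q @[q --> p] --> Defs.coord k p.
    have := @Defs.coord_continuous _ _ M k.
    rewrite continuous_open_subspace; last exact: dom_open.
    by apply; rewrite inE.
  have := cc _ (mean_curvature_locally_constant (coord_img kp)).
  by move=> H; near=> q; split; near: q.
pose S := [set p : M | exists k, dom k p /\
  mean_curvature k (Defs.coord k p) = mean_curvature i u].
have SE (p : M) (k : chart M) : dom k p ->
    S p <-> mean_curvature k (Defs.coord k p) = mean_curvature i u.
  move=> kp; split=> [[l [lp E]]|E].
    exact: (etrans (mean_curvature_chart kp lp) E).
  by exists k; split; [exact: kp|exact: E].
have oS : open S.
  rewrite openE => p [k [kp H]]; rewrite /interior.
  have L := loc k p kp.
  near=> q.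
  have Hq : dom k q /\ mean_curvature k (Defs.coord k q) =
     mean_curvature k (Defs.coord k p) by near: q.
  case: Hq => kq Hq.
  exists k.
  split.
    exact: kq.
  refine (etrans Hq _).
  exact H.
have oSC : open (~` S).
  rewrite openE => p Sp; rewrite /interior.
  have [k kp] := chart_cover p.
  have L := loc k p kp.
  near=> q.
  have Hq : dom k q /\ mean_curvature k (Defs.coord k q) =
     mean_curvature k (Defs.coord k p) by near: q.
  case: Hq => kq Hq /(SE q k kq) H.
  apply: Sp; apply/(SE p k kp).
  refine (etrans (esym Hq) _).
  exact H.
have ST : S = [set: M].
  apply: (@manifold_connected _ _ M).
  - by exists (param i u); exists i; rewrite paramK//; split=> //; exact: param_dom.
  - by exists S => //; rewrite setTI.
  - by exists S; [rewrite -openC|rewrite setTI].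
have : S (param j v) by rewrite ST.
move=> /(SE _ _ (param_dom Uv)) E.
rewrite (paramK Uv) in E.
exact: esym E.
Unshelve. all: by end_near. Qed.

End PrincipalCurvatures.

Theorem corollary3p15 (R : realType) (m n : nat) (hm : (2 < m)%N)
    (M : sphere_submanifold R m n)
    (hbih : proper_biharmonic M)
    (hH : parallel_mean_curv M)
    (hA : parallel_A_H M)
    (hnorm : forall (i : chart M) (u : 'rV[R]_m), img i u ->
      0 < mean_curvature i u < (m%:R - 2%:R) / m%:R) :
  exists (lambda mu : R) (m1 m2 : nat),
    [/\ lambda <> mu, m1 <> m2,
      (forall (i : chart M) (u : 'rV[R]_m), img i u ->
        [/\ forall a : R, eigenvalue (A_H i u) a <-> a = lambda \/ a = mu,
            \rank (eigenspace (A_H i u) lambda) = m1,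
            \rank (eigenspace (A_H i u) mu) = m2 &
            mean_curvature i u = `|m1%:R - m2%:R| / m%:R]),
      lambda = (m1%:R - m2%:R) / m%:R &
      mu = - ((m1%:R - m2%:R) / m%:R)].
Proof.
have [bih nharm] := hbih.
have [i0 [u0 U0]] : exists (i : chart M) u, img i u.
  apply: contrapT => H; apply: nharm => i u Uu; exfalso.
  by apply: H; exists i, u.
pose h := mean_curvature i0 u0.
have /andP[h0 h1] := mean_curvature_bounds hm hnorm U0; rewrite -/h in h0 h1.
have p1 : 0 < 1 + h by lra.
have p2 : 0 < 1 - h by lra.
have mR0 : 0 < m%:R :> R by rewrite ltr0n (ltn_trans _ hm).
have const (i : chart M) u : img i u -> mean_curvature i u = h.
  move=> Uu.
  exact: (@mean_curvature_constant R m n M hm bih hH hA hnorm i i0 u u0 Uu U0).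
pose m1 := \rank (eigenspace (A_H i0 u0) h).
pose m2 := \rank (eigenspace (A_H i0 u0) (- h)).
have Rpos (i : chart M) u : img i u ->
    (\rank (eigenspace (A_H i u) h))%:R = m%:R * (1 + h) / 2 :> R.
  move=> Uu; have := rank_eigenspace_pos hm bih hH hA hnorm Uu.
  by rewrite const.
have Rneg (i : chart M) u : img i u ->
    (\rank (eigenspace (A_H i u) (- h)))%:R = m%:R * (1 - h) / 2 :> R.
  move=> Uu; have := rank_eigenspace_neg hm bih hH hA hnorm Uu.
  by rewrite const.
have R1 : m1%:R = m%:R * (1 + h) / 2 :> R by exact: Rpos.
have R2 : m2%:R = m%:R * (1 - h) / 2 :> R by exact: Rneg.
have hE : (m1%:R - m2%:R) / m%:R = h.
  by rewrite R1 R2; field; rewrite gt_eqF.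
have x0 : 0 < m1%:R - m2%:R :> R.
  rewrite R1 R2 (_ : _ - _ = m%:R * h); last by field.
  exact: (mulr_gt0 mR0 h0).
exists h, (- h), m1, m2; split.
- by move=> hh; lra.
- by move=> m12; move: hE h0; rewrite m12 subrr mul0r => <-; rewrite ltxx.
- move=> i u Uu; split.
  + move=> a; split.
      move=> ea; apply: (eigenvalue_square_scalar _ ea).
      by have := A_H_square hm bih hH hA Uu; rewrite const.
    have pos (c : R) : 0 < c -> m%:R * c / 2 != 0 :> R.
      move=> c0; apply: lt0r_neq0; apply: divr_gt0; last exact: ltr0Sn.
      exact: (mulr_gt0 mR0 c0).
    case=> ->; rewrite /eigenvalue -mxrank_eq0 -(eqr_nat R).
      exact: (etrans (congr1 (fun z : R => z != 0) (Rpos i u Uu)) (pos _ p1)).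
    exact: (etrans (congr1 (fun z : R => z != 0) (Rneg i u Uu)) (pos _ p2)).
  + apply/eqP; rewrite -(eqr_nat R); apply/eqP.
    exact: (etrans (Rpos i u Uu) (esym R1)).
  + apply/eqP; rewrite -(eqr_nat R); apply/eqP.
    exact: (etrans (Rneg i u Uu) (esym R2)).
  + apply: (etrans (const i u Uu)); apply: (etrans (esym hE)).
    exact: (congr1 (fun z : R => z / m%:R) (esym (gtr0_norm x0))).
- exact: (esym hE).
- exact: (congr1 -%R (esym hE)).
Qed.
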